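(* Let $\mathcal H$ be a family of graphs and let $m:=\min\{\chi(H):H\in\mathcal H\}-1\ge2$. Consider the Turán problem $\mathrm{ex}(n,\mathcal H)$, i.e. the problem with $\kappa=2$, $\gamma(K_2)=1$, $\gamma(\overline{K_2})=0$ (so $\Lambda(G)=e(G)$) and admissible graphs $\mathcal G=\mathrm{Forb}(\mathcal H^\uparrow)$. Then: (1) The problem is perfectly $K_m$-stable if and only if there is an integer $q$ such that the graph obtained from $K_m^q$ by adding one edge is not $\mathcal H^\uparrow$-free. (2) If in addition $\mathcal H$ is finite, then the problem is robustly $K_m$-stable if and only if there is an integer $q$ such that the graph obtained from $K_m^q$ by adding some forest inside one of its parts is not $\mathcal H^\uparrow$-free.
   Context: All graphs are finite and simple; ''subgraph'' means induced subgraph; $\chi$ is the chromatic number. $\mathcal H^\uparrow$ is the family of all graphs obtained from members of $\mathcal H$ by adding some (possibly no) missing edges; a graph is $\mathcal H^\uparrow$-free if it has no induced subgraph isomorphic to a member of $\mathcal H^\uparrow$, and $\mathrm{Forb}(\mathcal H^\uparrow)$ is the class of such graphs. $\lambda(G)=e(G)/\binom{v(G)}2$ and $\lambda(n,\mathcal G)=\max\{\lambda(G):G\in\mathcal G,v(G)=n\}$ (so $\lambda(n,\mathcal G)\binom n2=\mathrm{ex}(n,\mathcal H)$). For a graph $B$ on $[m]$ and disjoint sets $V_1,\dots,V_m$, the blow-up $B(V_1,\dots,V_m)$ has vertex set $\bigcup V_i$, with $u\in V_i,w\in V_j$ adjacent iff $ij\in E(B)$; $B()$ is the family of all blow-ups.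 $K_m^q$ is the blow-up of $K_m$ with $m$ parts each of size $q$; its ''parts'' are these $m$ sets. $\delta_{\mathrm{edit}}(G,B())$ is the minimal number of adjacency changes turning $G$ (order $n$) into a blow-up of $B$, divided by $\binom n2$. The problem is perfectly $B$-stable if there is $C>0$ with $\delta_{\mathrm{edit}}(G,B())\le C(\lambda(n,\mathcal G)-\lambda(G))$ for all $G\in\mathcal G$ of order $n\ge C$; robustly $B$-stable if there is $C>0$ with $\delta_{\mathrm{edit}}(G,B())\le C\max(1/n,\lambda(n,\mathcal G)-\lambda(G))$ for all $G\in\mathcal G$ of order $n\ge C$. *)

(* Defs.v *)
From HB Require Import structures.
From mathcomp Require Import all_boot all_order all_algebra.
From mathcomp Require Import boolp classical_sets reals.

Set Implicit Arguments.
Unset Strict Implicit.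
Unset Printing Implicit Defensive.

Import Order.TTheory GRing.Theory Num.Theory.
Local Open Scope ring_scope.

Record sgraph : Type := SGraph {
  vertex :> finType;
  adj : rel vertex;
  adj_sym : symmetric adj;
  adj_irr : irreflexive adj }.

Definition edges (G : sgraph) : {set {set G}} :=
  [set [set p.1; p.2] | p in [pred p : G * G | adj p.1 p.2]]%SET.

(** Members of [S] that are not pairs are ignored. *)
Section GraphOf.
Variables (T : finType) (S : {set {set T}}).
Let e : rel T := fun u v => (u != v) && ([set u; v]%SET \in S).
Lemma graph_of_sym : symmetric e.
Proof. by move=> u v; rewrite /e eq_sym finset.setUC. Qed.
Lemma graph_of_irr : irreflexive e.
Proof. by move=> u; rewrite /e eqxx. Qed.
Definition graph_of : sgraph := SGraph graph_of_sym graph_of_irr.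
End GraphOf.

Definition add_edges (G : sgraph) (S : {set {set G}}) : sgraph :=
  graph_of (edges G :|: S)%SET.

Definition complete_graph (m : nat) : sgraph :=
  @SGraph 'I_m (fun i j => i != j) (fun i j => congr1 negb (eq_sym i j))
    (fun i => congr1 negb (eqxx i)).

(** The blow-up [B(V_1, ..., V_m)] with [V_i = f @^-1 i]; parts may be empty. *)
Definition blowup (B : sgraph) (T : finType) (f : T -> B) : sgraph :=
  @SGraph T (fun u v => adj (f u) (f v)) (fun u v => adj_sym (f u) (f v))
    (fun u => adj_irr (f u)).

Definition complete_blowup (m q : nat) : sgraph :=
  @blowup (complete_graph m) ('I_m * 'I_q)%type fst.

Definition blowup_part (m q : nat) (i : 'I_m) : {set complete_blowup m q} :=
  [set x : 'I_m * 'I_q | x.1 == i]%SET.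

Definition is_forest (G : sgraph) : Prop :=
  forall c : seq G, (2 < size c)%N -> ~ ucycle (@adj G) c.

Definition isomorphic (G H : sgraph) : Prop :=
  exists2 f : G -> H, bijective f & forall u v, adj (f u) (f v) = adj u v.

Definition induced_sub (H G : sgraph) : Prop :=
  exists2 f : H -> G, injective f & forall u v, adj (f u) (f v) = adj u v.

Definition colorable (G : sgraph) (k : nat) : bool :=
  [exists f : {ffun G -> 'I_k}, forall u, forall v, adj u v ==> (f u != f v)].

Lemma colorable_card (G : sgraph) : exists k, colorable G k.
Proof.
exists #|G|; apply/existsP; exists [ffun u => enum_rank u].
apply/forallP=> u; apply/forallP=> v; apply/implyP=> uv.
rewrite !ffunE (inj_eq enum_rank_inj).
by apply: contraTneq uv => ->; rewrite adj_irr.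
Qed.

Definition chi (G : sgraph) : nat := ex_minn (colorable_card G).

Definition graph_family := sgraph -> Prop.

Definition min_chi (F : graph_family) (k : nat) : Prop :=
  (exists2 H, F H & chi H = k) /\ (forall H, F H -> (k <= chi H)%N).

(** Finiteness is up to isomorphism. *)
Definition finite_family (F : graph_family) : Prop :=
  exists (k : nat) (s : 'I_k -> sgraph),
    forall H, F H -> exists i, isomorphic H (s i).

(** [F^up], closed under isomorphism: [G] has, up to relabelling, the vertices
    of some [H] in [F] and at least its edges. *)
Definition up (F : graph_family) : graph_family := fun G =>
  exists2 H, F H &
    exists2 f : H -> G, bijective f & forall u v, adj u v -> adj (f u) (f v).

Definition Forb (F : graph_family) : graph_family := fun G =>
  ~ exists2 H, F H & induced_sub H G.

Definition density (R : realType) (G : sgraph) : R :=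
  #|edges G|%:R / 'C(#|G|, 2)%:R.

(** The densities of graphs of order [n] form a finite set, so this supremum is
    a maximum as soon as the family has a graph of order [n]. *)
Definition max_density (R : realType) (F : graph_family) (n : nat) : R :=
  sup [set x | exists G, [/\ F G, #|G| = n & x = density R G]]%classic.

Definition edit_dist (T : finType) (e1 e2 : rel T) : nat :=
  #|[set [set p.1; p.2] | p in [pred p : T * T | e1 p.1 p.2 != e2 p.1 p.2]]%SET|.

(** Every blow-up of [B] on the vertex set of [G] is [blowup f] for some [f], and
    no two graphs on that set are at distance more than ['C(#|G|, 2)]. *)
Definition edit_density (R : realType) (G B : sgraph) : R :=
  (\big[minn/'C(#|G|, 2)]_(f : {ffun G -> B})
     edit_dist (@adj G) (@adj (blowup f)))%:R / 'C(#|G|, 2)%:R.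

Definition perfectly_stable (R : realType) (F : graph_family) (B : sgraph) : Prop :=
  exists2 C : R, 0 < C & forall G, F G -> C <= #|G|%:R ->
    edit_density R G B <= C * (max_density R F #|G| - density R G).

Definition robustly_stable (R : realType) (F : graph_family) (B : sgraph) : Prop :=
  exists2 C : R, 0 < C & forall G, F G -> C <= #|G|%:R ->
    edit_density R G B <=
      C * Num.max (#|G|%:R^-1) (max_density R F #|G| - density R G).

(* Main.v *)
Require Import Defs.
From mathcomp Require Import all_boot all_order all_algebra.
From mathcomp Require Import reals.
From mathcomp Require Import perm.
From mathcomp Require Import zify ring lra.

Set Implicit Arguments.
Unset Strict Implicit.
Unset Printing Implicit Defensive.

Import Order.TTheory GRing.Theory Num.Theory.

(** Sufficiency.  A graph [G] with almost as many edges as the Turán graph and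
    without [K_{m+1}^q] is close to complete [m]-partite (Erdős–Simonovits);
    take a maximum [m]-cut of [G], with [B] edges inside the classes and [M]
    missing edges between them.  A vertex with many neighbours in its own class
    has, by maximality, many in every class, so it is joined to a copy of
    [K_m^q]; for a single added edge there is no such vertex, and for a forest
    there are boundedly many, since otherwise [q] of them would extend a common
    [K_m^q] to [K_{m+1}^q].  Among the vertices with few missing edges an inner
    edge, respectively linearly many inner edges, would give the forbidden graph.
    The other inner edges are at vertices with many missing edges and few inner
    ones, so [2 B <= M], respectively [2 B <= M + O(n)], while the gap to the
    maximum is at least [M - B].

    Necessity.  If the condition fails, adding to [K_m^q] one edge, respectively
    a graph without short cycles and with superlinearly many edges, gives an
    admissible graph; an extremal graph of the same order then has that many
    more edges than every complete [m]-partite graph. *)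

(** * Degrees and complete multipartite subgraphs *)

(** All counts run over ordered pairs: [vol], [internal] and the sum of [missing] are twice numbers
    of edges. No extremal number is computed. Members of the family have chromatic number above m,
    so every complete m-partite graph is admissible, and comparing G with the blow-up on its own cut
    shows that the gap, in edges, is at least M - B. With 2 B <= M the edit distance B + M is then
    at most three times the gap. Edge and forest share one argument, an edge being a forest:
    [has_pattern] asks for a graph on q vertices joined to a K_{m-1}^q. A forest embeds in a
    complete bipartite graph, so excluding the pattern excludes K_{m+1}^q, which is what the
    stability theorem for dense graphs requires. The two cases part only at vertices with many inner
    neighbours: one such vertex can be an end of a single added edge, while against a forest such
    vertices can only be bounded in number, which costs the error O(n). Finiteness of the family
    bounds the orders of its members; to them a graph whose cycles are all longer than that bound is
    a forest. *)

Definition deg (T : finType) (e : rel T) (W : {set T}) (v : T) : nat :=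
  #|[set u in W | e v u]|.

Definition vol (T : finType) (e : rel T) (W : {set T}) : nat :=
  \sum_(v in W) deg e W v.

(** Indexing by [nat] with guards [i < m] lets a part be appended by an [if] on the index, without
    casts between ordinals. Disjointness of the parts is left to irreflexivity of [e]. *)
Definition has_blowup (T : finType) (e : rel T) (W : {set T}) (m q : nat) :=
  exists A : nat -> {set T},
    [/\ forall i, i < m -> A i \subset W,
        forall i, i < m -> #|A i| = q &
        forall i j, i < m -> j < m -> i != j ->
          forall u v, u \in A i -> v \in A j -> e u v].

Lemma card_bigcup_le (I T : finType) (P : pred I) (A : I -> {set T}) :
  #|\bigcup_(i | P i) A i| <= \sum_(i | P i) #|A i|.
Proof.
apply: (big_ind2 (fun (X : {set T}) n => #|X| <= n)) => [|X x Y y Xx Yy|//].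
  by rewrite cards0.
by apply: leq_trans (leq_add Xx Yy); rewrite cardsU leq_subr.
Qed.

Section Degrees.
Variables (T : finType) (e : rel T).

Lemma degE (W : {set T}) v : deg e W v = \sum_(u in W) e v u.
Proof.
rewrite /deg -sum1_card big_mkcond [RHS]big_mkcond /=; apply: eq_bigr => u _.
by rewrite inE; case: (u \in W); case: (e v u).
Qed.

Lemma deg_le_card (W : {set T}) v : deg e W v <= #|W|.
Proof. by apply: subset_leq_card; apply/subsetP => u; rewrite inE => /andP[]. Qed.

Lemma deg_sub (A B : {set T}) v : A \subset B -> deg e A v <= deg e B v.
Proof.
move=> AB; apply: subset_leq_card; apply/subsetP => u; rewrite !inE.
by case/andP => /(subsetP AB) -> ->.
Qed.

(** The vertices of [U] have at most [2 ^ #|K|] different traces on [K]; [Z] is the most frequent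
    one. *)
Lemma pigeonhole_trace (U K : {set T}) :
  exists2 Z : {set T}, Z \subset K &
    #|U| <= #|[set v in U | [set u in K | e v u] == Z]| * 2 ^ #|K|.
Proof.
pose F (Z : {set T}) := #|[set v in U | [set u in K | e v u] == Z]|.
have s0 : set0 \in powerset K by rewrite inE sub0set.
have [Z ZK maxZ] := @arg_maxnP _ set0 (mem (powerset K)) F s0.
exists Z; first by rewrite -powersetE.
have -> : #|U| = \sum_(Z in powerset K) F Z.
  rewrite -sum1_card (partition_big (fun v => [set u in K | e v u])
    (mem (powerset K))) /=; last first.
    by move=> v _; rewrite inE; apply/subsetP => u; rewrite inE => /andP[].
  by apply: eq_bigr => X _; rewrite /F -sum1_card; apply: eq_bigl => v; rewrite inE.
rewrite mulnC -card_powerset -sum_nat_const.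
by apply: leq_sum => X XK; exact: maxZ.
Qed.

Lemma subset_of_card (B : {set T}) q : q <= #|B| ->
  exists2 A : {set T}, A \subset B & #|A| = q.
Proof.
move=> qB; exists [set x in take q (enum B)].
  by apply/subsetP => x; rewrite inE => /mem_take; rewrite mem_enum.
rewrite cardsE (card_uniqP _) ?take_uniq ?enum_uniq // size_take -cardE.
by case: ltngtP qB.
Qed.

Lemma has_blowup_leq (W : {set T}) m q (A : nat -> {set T}) :
  (forall i, i < m -> A i \subset W) -> (forall i, i < m -> q <= #|A i|) ->
  (forall i j, i < m -> j < m -> i != j ->
     forall u v, u \in A i -> v \in A j -> e u v) -> has_blowup e W m q.
Proof.
move=> AW Aq Ae.
have: forall i : 'I_m, exists B : {set T}, (B \subset A i) && (#|B| == q).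
  by move=> i; case: (subset_of_card (Aq i (ltn_ord i))) => B ? /eqP ?; exists B; apply/andP.
case/fin_all_exists => B HB.
pose B' i := if insub i is Some i' then B i' else set0.
have BA i (im : i < m) : B' i \subset A i /\ #|B' i| = q.
  by rewrite /B' insubT; case/andP: (HB (Ordinal im)) => ? /eqP.
exists B'; split=> [i im|i im|i j im jm ij u v uB vB].
- by apply: subset_trans (AW i im); case: (BA i im).
- by case: (BA i im).
- by apply: (Ae i j) => //; [move: u uB|move: v vB]; apply/subsetP; case: (BA _ im); case: (BA _ jm).
Qed.

Lemma has_blowup_sub (U W : {set T}) m q :
  U \subset W -> has_blowup e U m q -> has_blowup e W m q.
Proof.
move=> UW [A [AU Aq Ae]]; exists A; split=> // i im.
exact: subset_trans (AU i im) UW.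
Qed.

Lemma has_blowup1 (W : {set T}) q : q <= #|W| -> has_blowup e W 1 q.
Proof.
case/subset_of_card => A AW Aq; exists (fun=> A); split=> // i j.
by rewrite !ltnS !leqn0 => /eqP -> /eqP ->.
Qed.

Hypotheses (esym : symmetric e) (eirr : irreflexive e).

Lemma sum_deg_exchange (A B : {set T}) :
  \sum_(v in A) deg e B v = \sum_(u in B) deg e A u.
Proof.
under eq_bigr do rewrite degE.
rewrite exchange_big /=; apply: eq_bigr => u _; rewrite degE.
by apply: eq_bigr => v _; rewrite esym.
Qed.

Lemma vol_rem (W : {set T}) v :
  v \in W -> vol e W = vol e (W :\ v) + (deg e W v).*2.
Proof.
move=> vW.
have dv : deg e W v = deg e (W :\ v) v.
  by rewrite !degE (big_setD1 v) //= eirr.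
rewrite /vol (big_setD1 v) //=.
under eq_bigr => u _ do rewrite degE (big_setD1 v) //= -degE.
rewrite big_split /= -addnn [X in _ + (X + _)](_ : _ = deg e W v).
  by rewrite addnA addnC.
by rewrite dv degE; apply: eq_bigr => u _; rewrite esym.
Qed.

(* Maximising [vol W - w #|W|]: for [w] quadratic this is the usual deletion of
   low degree vertices, for [w] linear it gives a subgraph of large minimum
   degree. *)
Lemma peel (R : realType) (w : nat -> R) (W0 : {set T}) :
  exists W : {set T}, [/\ W \subset W0,
    ((vol e W0)%:R - w #|W0| <= (vol e W)%:R - w #|W|)%R &
    forall v, v \in W -> (w #|W| - w #|W|.-1 <= (deg e W v)%:R * 2%:R)%R].
Proof.
pose F (W : {set T}) := ((vol e W)%:R - w #|W| : R)%R.
have s0 : W0 \in powerset W0 by rewrite inE.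
case: (@Order.TotalTheory.arg_maxP _ _ _ W0 (mem (powerset W0)) F s0) => W WW0 maxW.
exists W; split; [by rewrite -powersetE | exact: maxW |] => v vW.
have WvW0 : W :\ v \in powerset W0.
  by rewrite powersetE (subset_trans (subsetDl _ _)) // -powersetE.
have := maxW _ WvW0; rewrite /F (vol_rem vW) [#|W|](cardsD1 v) vW add1n /=.
rewrite natrD -muln2 natrM; lra.
Qed.

(* Many vertices with [q] neighbours in each part share the same trace on the
   blow-up, so [q] of them form an additional part. *)
Lemma extend_blowup (W : {set T}) m q t (A : nat -> {set T}) :
  (forall i, i < m -> A i \subset W) -> (forall i, i < m -> #|A i| = t) ->
  (forall i j, i < m -> j < m -> i != j ->
     forall u v, u \in A i -> v \in A j -> e u v) ->
  ~ has_blowup e W m.+1 q ->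
  #|[set v in W | [forall i : 'I_m, q <= deg e (A i) v]]| <= q * 2 ^ (m * t).
Proof.
move=> AW At Ae noK; set U := [set v in W | _]; rewrite leqNgt; apply/negP => bigU.
pose K := \bigcup_(i < m) A i.
have cK : #|K| <= m * t.
  apply: leq_trans (card_bigcup_le _ _) _.
  by rewrite (eq_bigr (fun=> t)) => [|i _]; rewrite ?At // sum_nat_const card_ord.
have [Z ZK HZ] := pigeonhole_trace U K.
set B := [set v in U | _] in HZ.
have Bq : q <= #|B|.
  have := leq_trans (leq_trans bigU HZ) (leq_mul (leqnn _) (leq_pexp2l (isT : 0 < 2) cK)).
  by rewrite ltn_pmul2r ?expn_gt0 // => /ltnW.
have BZ v u : v \in B -> u \in Z -> e v u.
  rewrite inE => /andP[_ /eqP <-]; by rewrite inE => /andP[].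
(* [B] becomes part m and the old parts are cut down to the common trace [Z]. Each keeps q vertices,
   because a member of [B] has q neighbours in every part and all of them lie in [Z]. *)
apply: noK; apply: (@has_blowup_leq _ _ _ (fun i => if i == m then B else A i :&: Z)).
- move=> i; rewrite ltnS leq_eqVlt; case: eqP => [_ _|_ /= im].
    by apply/subsetP => v; rewrite inE => /andP[]; rewrite inE => /andP[].
  by apply: subset_trans (AW i im); apply: subsetIl.
- move=> i; rewrite ltnS leq_eqVlt; case: eqP => [//|_ /= im].
  case: (posnP q) => [->//|q0].
  have /card_gt0P[v vB] : 0 < #|B| by apply: leq_trans Bq.
  have := vB; rewrite inE => /andP[]; rewrite inE => /andP[_ /forallP/(_ (Ordinal im)) /=].
  move=> qv /eqP ZE; apply: leq_trans qv _; apply: subset_leq_card.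
  apply/subsetP => u; rewrite !inE => /andP[uA evu]; rewrite uA -ZE inE evu andbT.
  by apply/bigcupP; exists (Ordinal im).
- move=> i j; rewrite !ltnS (leq_eqVlt i) (leq_eqVlt j).
  case: (eqVneq i m) => [-> _|im /= i_m]; case: (eqVneq j m) => [->|jm /= j_m] //=.
  + by move=> _ u v uB; rewrite inE => /andP[_]; exact: BZ.
  + by move=> _ _ u v; rewrite inE => /andP[_ uZ] vB; rewrite esym; exact: BZ.
  + by move=> ij u v; rewrite !inE => /andP[uA _] /andP[vA _]; apply: (Ae i j).
Qed.
End Degrees.

(** * The Erdős–Stone theorem *)

Lemma exists_nat_ge (R : realType) (x : R) : exists n : nat, (x <= n%:R)%R.
Proof.
case: (lerP 0%R x) => [x0|x0]; last by exists 0%N; apply: ltW.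
by exists (Num.bound x); apply: ltW; apply: archi_boundP.
Qed.

Section TraceCount.
Variables (T : finType) (e : rel T) (W : {set T}) (m t q h : nat).
Variable A : nat -> {set T}.
Hypothesis At : forall i, i < m -> #|A i| = t.

Lemma sum_deg_parts_le (v : T) : \sum_(i < m) deg e (A i) v <= m * t.
Proof.
rewrite (_ : m * t = \sum_(i < m) t); last by rewrite sum_nat_const card_ord.
by apply: leq_sum => i _; rewrite -(At (ltn_ord i)) deg_le_card.
Qed.

Lemma sum_deg_parts_poor (v : T) (i : 'I_m) : deg e (A i) v <= q ->
  \sum_(j < m) deg e (A j) v <= m.-1 * t + q.
Proof.
move=> vq; rewrite (bigD1 i) //= addnC leq_add //.
rewrite (_ : m.-1 * t = \sum_(j < m | j != i) t).
  by apply: leq_sum => j _; rewrite -(At (ltn_ord j)) deg_le_card.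
by rewrite sum_nat_const (@eq_card _ _ (predC1 i)) // cardC1 card_ord.
Qed.

Let rich := [set v in W | [forall i : 'I_m, q <= deg e (A i) v]].

(** Edges between [W] and the blow-up, counted from [W]: a vertex outside [rich] has fewer than q
    neighbours in some part and sends at most (m-1)t + q edges; one that falls short of this by h
    gives h back. Erdős-Stone takes h = 0; stability takes h large to bound the number of vertices
    that fall short. *)
Lemma trace_count :
  \sum_(v in W) \sum_(i < m) deg e (A i) v +
    #|[set v in W :\: rich | \sum_(i < m) deg e (A i) v + h <= m.-1 * t + q]| * h
  <= #|rich| * (m * t) + #|W| * (m.-1 * t + q).
Proof.
set L := [set v in _ | _].
have LW : L \subset W by apply/subsetP => v; rewrite inE => /andP[/setDP[]].
have rW : rich \subset W by apply/subsetP => v; rewrite inE => /andP[].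
have sub (B : {set T}) k : B \subset W ->
    #|B| * k = \sum_(v in W) (if v \in B then k else 0).
  move=> BW; rewrite -big_mkcondr -sum_nat_const; apply: eq_bigl => v.
  by case vB: (v \in B); rewrite ?andbF // (subsetP BW).
rewrite (sub L) // (sub rich) // -sum_nat_const -!big_split /=.
apply: leq_sum => v vW; case: ifP => [vL|_].
  by move: vL; rewrite inE => /andP[_]; case: ifP => _ // H; apply: leq_trans H (leq_addl _ _).
rewrite addn0; case: ifP => [_|vr].
  by apply: leq_trans (sum_deg_parts_le v) (leq_addr _ _).
move: vr; rewrite inE vW /= => /negbT; rewrite negb_forall => /existsP[i].
by rewrite -ltnNge => /ltnW /sum_deg_parts_poor.
Qed.

Lemma sum_deg_parts_ge (R : realType) (b : R) :
  symmetric e -> (forall i, i < m -> A i \subset W) ->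
  (forall v, v \in W -> (b <= (deg e W v)%:R)%R) ->
  ((m * t)%:R * b <= (\sum_(v in W) \sum_(i < m) deg e (A i) v)%:R)%R.
Proof.
move=> esym AW Hb; rewrite exchange_big /=.
rewrite (_ : (m * t)%:R * b = \sum_(i < m) \sum_(x in A i) b)%R; last first.
  under eq_bigr => i _ do rewrite sumr_const At //.
  by rewrite sumr_const card_ord -mulrnA mulr_natl mulnC.
rewrite natr_sum; apply: ler_sum => i _.
rewrite sum_deg_exchange // natr_sum; apply: ler_sum => x xA.
by apply: Hb; apply: (subsetP (AW _ (ltn_ord i))).
Qed.

End TraceCount.

Section ErdosStone.
Variable R : realType.

(** By the degrees of the vertices of K_m^t, a vertex of [W] has on average at least (m-1)t + cmt
    neighbours in it. As ct >= q+1, this exceeds by 1 what a vertex with fewer than q neighbours in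
    some part can have, so the number of vertices with q neighbours in every part grows with [W],
    and [extend_blowup] applies. *)
Lemma blowup_step m q (c : R) : 0 < m -> (0 < c)%R -> exists t n0 : nat,
  forall (T : finType) (e : rel T) (W : {set T}), symmetric e -> irreflexive e ->
    n0 <= #|W| ->
    (forall v, v \in W -> ((1 - m%:R^-1 + c) * #|W|%:R <= (deg e W v)%:R :> R)%R) ->
    has_blowup e W m t -> has_blowup e W m.+1 q.
Proof.
move=> m0 c0; have [t Ht] := exists_nat_ge (q.+1%:R / c)%R.
exists t, (q * 2 ^ (m * t) * (m * t)).+1 => T e W esym eirr nW dW [A [AW At Ae]].
case: (boolp.pselect (has_blowup e W m.+1 q)) => // noK; exfalso.
have rich := extend_blowup esym AW At Ae noK.
have := sum_deg_parts_ge At esym AW dW.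
have := trace_count e W q 0 At; rewrite muln0 addn0 => H1 H2.
have {H1} H1 := leq_trans H1 (leq_add (leq_mul rich (leqnn (m * t))) (leqnn _)).
move: H1; rewrite -(ler_nat R) => H1; have {H1 H2} := le_trans H2 H1.
set X := q * _ * _ in nW *.
have mt : ((m * t)%:R * (1 - m%:R^-1 + c) = (m.-1 * t)%:R + c * (m * t)%:R :> R)%R.
  have mi : (m%:R * m%:R^-1 = 1 :> R)%R by rewrite mulfV // pnatr_eq0 -lt0n.
  have mp : (m%:R = m.-1%:R + 1 :> R)%R by rewrite natr1 prednK.
  rewrite !natrM; transitivity ((m%:R - m%:R * m%:R^-1) * t%:R + c * (m%:R * t%:R) :> R)%R.
    by ring.
  by rewrite mi mp; ring.
rewrite mulrA mt natrD (natrM _ #|W|) (natrD _ (m.-1 * t)) => H.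
have ct : (q.+1%:R <= c * (m * t)%:R :> R)%R.
  have Ht' : (q.+1%:R <= c * t%:R :> R)%R by rewrite mulrC -ler_pdivrMr.
  apply: le_trans Ht' _; rewrite ler_pM2l // ler_nat; exact: leq_pmull.
have nW' : (X%:R < #|W|%:R :> R)%R by rewrite ltr_nat.
have : ((q.+1%:R) * #|W|%:R <= c * (m * t)%:R * #|W|%:R :> R)%R by rewrite ler_wpM2r.
rewrite -natr1; lra.
Qed.

(** Induction on m. Peeling leaves a set [W'] of linear size whose minimum degree exceeds (1 -
    1/m)|W'| by a linear term. Since 1 - 1/m is strictly above 1 - 1/(m-1), the induction hypothesis
    finds K_m^t in [W'], and [blowup_step] adds a part. *)
Lemma erdos_stone m q (c : R) : 0 < m -> (0 < c)%R -> exists n0 : nat,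
  forall (T : finType) (e : rel T) (W : {set T}), symmetric e -> irreflexive e ->
    n0 <= #|W| -> ((1 - m%:R^-1 + c) * #|W|%:R ^+ 2 <= (vol e W)%:R :> R)%R ->
    has_blowup e W m.+1 q.
Proof.
elim: m q c => // m IH q c _ c0.
have c40 : (0 < c / 4%:R)%R by rewrite divr_gt0.
have [i Hi] : exists i : R, i = (m.+1%:R^-1)%R by eexists.
have [t [n1 step]] := blowup_step q (ltn0Sn m) c40; rewrite -Hi in step.
have [n2 Hn2] : exists n2 : nat, forall (T : finType) (e : rel T) (W : {set T}),
    symmetric e -> irreflexive e -> n2 <= #|W| ->
    (forall v, v \in W -> ((1 - m.+1%:R^-1) * #|W|%:R <= (deg e W v)%:R :> R)%R) ->
    has_blowup e W m.+1 t.
  case: (posnP m) => [->|m0].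
    by exists t => T e W _ _ tW _; exact: has_blowup1.
  have c'0 : (0 < m%:R^-1 - m.+1%:R^-1 :> R)%R.
    by rewrite subr_gt0 ltf_pV2 ?posrE ?ltr0n // ltr_nat.
  have [n2 H] := IH t _ m0 c'0; exists n2 => T e W esym eirr n2W dW.
  apply: H => //; rewrite (_ : 1 - _ + _ = 1 - m.+1%:R^-1 :> R)%R; last by rewrite addrA subrK.
  rewrite expr2 mulrA [leLHS]mulr_natr -sumr_const /vol natr_sum; exact: ler_sum.
have [n0 Hn0] := exists_nat_ge (2%:R / c * (n1 + n2 + 2)%:R + 2%:R / c * (4%:R / c))%R.
rewrite -Hi; exists n0 => T e W esym eirr n0W HW; rewrite -?Hi in Hn2.
(* The excess c is split: one half forces [W'] to be linear in [W]; the other enters b, and the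
   minimum degree b|W'| - O(1) still exceeds (1 - i + c/4)|W'|. *)
pose b : R := (1 - i + c / 2%:R)%R.
have [W' [W'W gain mind]] := peel esym eirr (fun n => b * n%:R ^+ 2)%R W.
pose N : R := #|W|%:R%R; pose N' : R := #|W'|%:R%R.
rewrite -/N in HW gain; rewrite -/N' in gain mind.
apply: (has_blowup_sub W'W).
have NN' : (N' <= N :> R)%R by rewrite ler_nat subset_leq_card.
have nN : (n0%:R <= N :> R)%R by rewrite ler_nat.
have vN' : ((vol e W')%:R <= N' ^+ 2 :> R)%R.
  rewrite -natrX ler_nat -mulnn -sum_nat_const; apply: leq_sum => v _; exact: deg_le_card.
have c1 : (0 < 2%:R / c :> R)%R by rewrite divr_gt0.
have c2 : (0 < 4%:R / c :> R)%R by rewrite divr_gt0.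
have N0 : (0 < N)%R.
  apply: lt_le_trans nN; apply: lt_le_trans Hn0.
  by apply: addr_gt0; apply: mulr_gt0 => //; rewrite ltr0n addn2.
have /andP[m1 m1'] : (0 < (i : R) <= 1)%R.
  by rewrite Hi invr_gt0 ltr0n /= invf_le1 ?ltr0n // ler1n.
have b0 : (0 <= b)%R by rewrite /b; lra.
have N'0 : (0 <= N')%R by rewrite ler0n.
have N'big : (c / 2%:R * N <= N')%R.
  have H : (c / 2%:R * N ^+ 2 <= N' ^+ 2)%R.
    have -> : (c / 2%:R * N ^+ 2 = (1 - i + c) * N ^+ 2 - b * N ^+ 2)%R.
      by rewrite /b; field.
    have : (0 <= b * N' ^+ 2)%R by rewrite mulr_ge0 ?sqr_ge0.
    lra.
  rewrite -(ler_pM2r N0) (_ : _ * N * N = c / 2%:R * N ^+ 2)%R; last by ring.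
  apply: le_trans H _.
  by rewrite expr2 ler_wpM2l.
have N'big2 : ((n1 + n2 + 2)%:R + 4%:R / c <= N' :> R)%R.
  apply: le_trans N'big; apply: le_trans (_ : c / 2%:R * n0%:R <= _)%R.
    rewrite [leLHS](_ : _ = c / 2%:R * (2%:R / c * ((n1 + n2 + 2)%:R + 4%:R / c)))%R.
      by rewrite ler_wpM2l ?mulrDr // divr_ge0 // ltW.
    by field; rewrite gt_eqF.
  by rewrite ler_wpM2l ?divr_ge0 // ltW.
have N'nat : n1 + n2 + 2 <= #|W'|.
  rewrite -(ler_nat R); apply: le_trans N'big2; rewrite lerDl; exact: ltW.
have dW' v : v \in W' -> ((1 - i + c / 4%:R) * N' <= (deg e W' v)%:R)%R.
  move=> /mind.
  have -> : (#|W'|.-1%:R = N' - 1 :> R)%R by rewrite -subn1 natrB // (leq_trans _ N'nat) // addn2.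
  have : (4%:R + 2%:R * c <= c * N')%R.
    have : (2%:R + 4%:R / c <= N')%R.
      by apply: le_trans N'big2; rewrite lerD2r ler_nat leq_addl.
    rewrite -(ler_pM2l c0) mulrDr mulrCA mulfV ?gt_eqF //; lra.
  rewrite /b; nra.
apply: (step _ _ _ esym eirr) => //; first by move: N'nat; clear; lia.
apply: (Hn2 _ _ _ esym eirr) => //; first by move: N'nat; clear; lia.
move=> v /dW'; apply: le_trans; rewrite ler_wpM2r //; lra.
Qed.

End ErdosStone.

(** * Approximate stability *)

Definition common_nbrs (T : finType) (e : rel T) (A Z : {set T}) : {set T} :=
  [set u in A | [forall z in Z, e z u]].

Lemma common_nbrsP (T : finType) (e : rel T) (A Z : {set T}) u :
  reflect (u \in A /\ forall z, z \in Z -> e z u) (u \in common_nbrs e A Z).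
Proof.
rewrite inE; apply: (iffP andP) => -[uA H]; split=> //.
  by move=> z zZ; move/forallP: H => /(_ z); rewrite zZ.
by apply/forallP => z; apply/implyP; exact: H.
Qed.

Lemma card_common_nbrs (T : finType) (e : rel T) (A Z : {set T}) h :
  (forall z, z \in Z -> #|A| <= deg e A z + h) ->
  #|A| <= #|common_nbrs e A Z| + #|Z| * h.
Proof.
move=> Zh; pose non z := #|[set u in A | ~~ e z u]|.
have nonE z : deg e A z + non z = #|A|.
  rewrite /deg -(cardsID [set u | e z u] A); congr (_ + _); apply: eq_card => u.
    by rewrite !inE.
  by rewrite !inE andbC.
have AS : A \subset common_nbrs e A Z :|: \bigcup_(z in Z) [set u in A | ~~ e z u].
  apply/subsetP => u uA; rewrite in_setU; case: (boolP (u \in common_nbrs e A Z)) => //=.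
  rewrite inE uA /= negb_forall => /existsP[z]; rewrite negb_imply => /andP[zZ ezu].
  by apply/bigcupP; exists z; rewrite // inE uA.
apply: leq_trans (subset_leq_card AS) _; rewrite cardsU.
apply: leq_trans (leq_subr _ _) _; rewrite leq_add2l -sum_nat_const.
apply: leq_trans (card_bigcup_le _ _) _.
by apply: leq_sum => z zZ; have := Zh z zZ; rewrite -(nonE z) leq_add2l.
Qed.

(** A K_2^q inside [U] supplies two parts in place of part i. Its 2q vertices each miss at most h
    vertices of any other part, so t >= 2qh + q leaves q common neighbours there. *)
Lemma blowup_of_dense_class (T : finType) (e : rel T) (W U : {set T}) m q t h i
    (A : nat -> {set T}) :
  symmetric e ->
  (forall j, j < m -> A j \subset W) -> (forall j, j < m -> #|A j| = t) ->
  (forall j k, j < m -> k < m -> j != k ->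
     forall u v, u \in A j -> v \in A k -> e u v) ->
  i < m -> U \subset W -> q.*2 * h + q <= t ->
  (forall v j, v \in U -> j < m -> j != i -> t <= deg e (A j) v + h) ->
  has_blowup e U 2 q -> has_blowup e W m.+1 q.
Proof.
move=> esym AW At Ae im UW ht Uh [B [BU Bq Be]].
pose Z := B 0 :|: B 1.
have ZU : Z \subset U by rewrite subUset !BU.
have cZ : #|Z| <= q.*2.
  by rewrite cardsU (leq_trans (leq_subr _ _)) // !Bq // addnn.
pose N j := common_nbrs e (A j) Z.
have NA j u : u \in N j -> u \in A j by case/common_nbrsP.
have NZ j u z : u \in N j -> z \in Z -> e z u by case/common_nbrsP => _; apply.
have B0Z u : u \in B 0 -> u \in Z by rewrite inE => ->.
have B1Z u : u \in B 1 -> u \in Z by rewrite inE orbC => ->.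
have Nq j : j < m -> j != i -> q <= #|N j|.
  move=> jm ji; have := @card_common_nbrs T e (A j) Z h.
  rewrite At // => /(_ (fun z zZ => Uh z j (subsetP ZU z zZ) jm ji)) H.
  have {}H := leq_trans H (leq_add (leqnn _) (leq_mul cZ (leqnn h))).
  by have := leq_trans ht H; rewrite addnC leq_add2r.
pose A' j := if j == m then B 1 else if j == i then B 0 else N j.
have A'm : A' m = B 1 by rewrite /A' eqxx.
have im' : i == m = false by rewrite ltn_eqF.
have A'i : A' i = B 0 by rewrite /A' im' eqxx.
have casej j : j < m.+1 -> [\/ j = m, j = i | [/\ j < m, j != i & A' j = N j]].
  rewrite ltnS leq_eqVlt => /predU1P[->|jm]; first by constructor 1.
  case: (eqVneq j i) => [->|ji]; first by constructor 2.
  by constructor 3; rewrite /A' ltn_eqF // (negbTE ji).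
apply: (@has_blowup_leq _ _ _ _ _ A').
- move=> j /casej[->|->|[jm ji ->]]; rewrite ?A'm ?A'i.
  + by apply: subset_trans UW; exact: BU.
  + by apply: subset_trans UW; exact: BU.
  + by apply: subset_trans (AW j jm); apply/subsetP => u; exact: NA.
- move=> j /casej[->|->|[jm ji ->]]; rewrite ?A'm ?A'i ?Bq //; exact: Nq.
- move=> j k /casej[->|->|[jm ji ->]] /casej[->|->|[km ki ->]]; rewrite ?eqxx ?A'm ?A'i //.
  + by move=> _ u v uB vB; apply: (Be 1 0).
  + by move=> _ u v uB vN; apply: (NZ k) => //; exact: B1Z.
  + by move=> _ u v uB vB; apply: (Be 0 1).
  + by move=> _ u v uB vN; apply: (NZ k) => //; exact: B0Z.
  + by move=> _ u v uN vB; rewrite esym; apply: (NZ j) => //; exact: B1Z.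
  + by move=> _ u v uN vB; rewrite esym; apply: (NZ j) => //; exact: B0Z.
  + by move=> jk u v uN vN; apply: (Ae j k) => //; apply: NA.
Qed.

Section Stability.
Variable R : realType.

Definition internal (T : finType) (e : rel T) (W : {set T}) m (f : T -> 'I_m) : nat :=
  \sum_(v in W) deg e [set u in W | f u == f v] v.

Lemma internal_vol (T : finType) (e : rel T) (W : {set T}) m (f : T -> 'I_m) :
  internal e W f = \sum_(i < m) vol e [set u in W | f u == i].
Proof.
rewrite /internal (partition_big f predT) //=; apply: eq_bigr => i _.
rewrite /vol; apply: eq_big => [v|v]; first by rewrite !inE.
by move=> /andP[_ /eqP->].
Qed.

(** The graph of inner edges: through it [internal] becomes a [vol], and vertex deletion is treated
    once for both. *)
Definition same_class (T : finType) (e : rel T) m (f : T -> 'I_m) : rel T :=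
  fun u v => e u v && (f v == f u).

Lemma same_class_sym (T : finType) (e : rel T) m (f : T -> 'I_m) :
  symmetric e -> symmetric (same_class e f).
Proof. by move=> esym u v; rewrite /same_class esym eq_sym. Qed.

Lemma same_class_irr (T : finType) (e : rel T) m (f : T -> 'I_m) :
  irreflexive e -> irreflexive (same_class e f).
Proof. by move=> eirr u; rewrite /same_class eirr. Qed.

Lemma deg_same_class (T : finType) (e : rel T) (W : {set T}) m (f : T -> 'I_m) v :
  deg (same_class e f) W v = deg e [set u in W | f u == f v] v.
Proof. by apply: eq_card => u; rewrite !inE /same_class -andbA [e v u && _]andbC. Qed.

Lemma internalE (T : finType) (e : rel T) (W : {set T}) m (f : T -> 'I_m) :
  internal e W f = vol (same_class e f) W.
Proof. by apply: eq_bigr => v _; rewrite deg_same_class. Qed.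

Lemma vol_le_rem (T : finType) (e : rel T) (W X : {set T}) :
  symmetric e -> X \subset W ->
  vol e W <= (\sum_(v in X) deg e W v).*2 + vol e (W :\: X).
Proof.
move=> esym XW; have degD v : deg e W v = deg e X v + deg e (W :\: X) v.
  by rewrite !degE (big_setID X) /= (setIidPr XW).
rewrite {1}/vol (big_setID X) /= (setIidPr XW) -addnn -addnA leq_add2l.
under eq_bigr do rewrite degD.
rewrite big_split /= leq_add2r sum_deg_exchange //.
by apply: leq_sum => v _; apply: deg_sub; exact: subsetDl.
Qed.

Lemma internal_le (T : finType) (e : rel T) (W X : {set T}) m (f : T -> 'I_m) :
  symmetric e -> X \subset W ->
  internal e W f <= (#|X| * #|W|).*2 + internal e (W :\: X) f.
Proof.
move=> esym XW; rewrite !internalE.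
apply: leq_trans (vol_le_rem (same_class_sym f esym) XW) _.
rewrite leq_add2r leq_double -sum_nat_const.
by apply: leq_sum => v _; exact: deg_le_card.
Qed.

(** Erdős-Stone provides a K_m^t in [W], and vertices are classified by the part in which they have
    fewer than q neighbours. Boundedly many vertices have no such part, and few miss more than h
    vertices in the other parts; these form [X]. Outside [X] a class with quadratically many edges
    would contain K_2^q, hence [W] would contain K_{m+1}^q by [blowup_of_dense_class]. *)
Lemma stability_mindeg m q (d : R) : 1 < m -> (0 < d)%R ->
  exists2 eps : R, (0 < eps)%R & exists n0 : nat,
  forall (T : finType) (e : rel T) (W : {set T}), symmetric e -> irreflexive e ->
    n0 <= #|W| ->
    (forall v, v \in W -> ((1 - m%:R^-1 - eps) * #|W|%:R <= (deg e W v)%:R :> R)%R) ->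
    ~ has_blowup e W m.+1 q ->
    exists f : T -> 'I_m, ((internal e W f)%:R <= d * #|W|%:R ^+ 2 :> R)%R.
Proof.
case: m => // m; rewrite ltnS => m1 d0.
have [i Hi] : exists i : R, i = (m.+1%:R^-1)%R by eexists.
(* The count of edges to the blow-up tolerates a total shortfall of about q|W|, so a threshold h of
   order q/d leaves at most d|W|/8 vertices in [L]. *)
have [h Hh] := exists_nat_ge (32%:R * q.+1%:R / d)%R.
have hq : (32%:R * q.+1%:R <= d * h%:R)%R by rewrite [leRHS]mulrC -ler_pdivrMr.
have hR0 : (0 < h%:R :> R)%R.
  by rewrite -(pmulr_rgt0 _ d0); apply: lt_le_trans hq; rewrite mulr_gt0 ?ltr0n.
have h1 : (1 <= h%:R :> R)%R by rewrite ler1n -(ltr0n R).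
pose t := q.*2 * h + q.
pose c : R := (d / (2%:R * m.+1%:R))%R.
have c0 : (0 < c)%R by rewrite divr_gt0 // mulr_gt0 ?ltr0n.
have [n1 es1] := erdos_stone q (isT : 0 < 1) c0.
pose g : R := ((m%:R^-1 - i) / 2%:R)%R.
have g0 : (0 < g)%R.
  by rewrite divr_gt0 // subr_gt0 Hi ltf_pV2 ?posrE ?ltr0n // ltr_nat.
have [n2 es2] := erdos_stone t m1 g0.
pose M : R := (m.+1 * t).+1%:R%R.
have M0 : (0 < M)%R by rewrite ltr0n.
pose eps : R := Num.min g (d * h%:R / (32%:R * M))%R.
have eps0 : (0 < eps)%R by rewrite lt_min g0 divr_gt0 // mulr_gt0.
have epsg : (eps <= g)%R by rewrite ge_min lexx.
have epsM : (eps * (m.+1 * t)%:R <= d * h%:R / 32%:R)%R.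
  have : (eps * (32%:R * M) <= d * h%:R)%R.
    by rewrite -ler_pdivlMr ?mulr_gt0 // ge_min lexx orbT.
  have : (eps * (m.+1 * t)%:R <= eps * M)%R by rewrite ler_pM2l // ler_nat.
  lra.
pose C0 := q * 2 ^ (m.+1 * t).
have [n3 Hn3] := exists_nat_ge (16%:R * (C0 * (m.+1 * t).+1)%:R / d)%R.
have [n4 Hn4] := exists_nat_ge (n1%:R / c)%R.
exists eps => //; exists (n2 + n3 + n4 + 1) => T e W esym eirr nW dW noK.
rewrite -Hi in dW.
have [N HN] : exists N : R, N = (#|W|%:R)%R by eexists.
have N0 : (0 < N)%R by rewrite HN ltr0n; apply: leq_trans nW; rewrite addn1.
have nN2 : n2 <= #|W| by move: nW; clear; lia.
have nN3 : (n3%:R <= N)%R by rewrite HN ler_nat; move: nW; clear; lia.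
have nN4 : (n4%:R <= N)%R by rewrite HN ler_nat; move: nW; clear; lia.
have [A [AW At Ae]] : has_blowup e W m.+1 t.
  apply: es2 => //; rewrite -HN.
  have : ((1 - i - eps) * N ^+ 2 <= (vol e W)%:R)%R.
    rewrite expr2 mulrA {2}HN mulr_natr -sumr_const /vol natr_sum.
    by apply: ler_sum => v vW; rewrite HN; exact: dW.
  apply: le_trans; rewrite ler_wpM2r ?sqr_ge0 //; move: epsg; rewrite /g; lra.
have rich := extend_blowup esym AW At Ae noK.
have := sum_deg_parts_ge At esym AW dW.
have := trace_count e W q h At.
set rch := [set v in W | _] in rich *.
set L := [set v in W :\: rch | _].
rewrite -/C0 in rich; rewrite -HN => H1 H2.
have LN : (#|L|%:R * 8%:R <= d * N)%R.
  have mt : ((m.+1 * t)%:R * (1 - i - eps) = (m * t)%:R - eps * (m.+1 * t)%:R)%R.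
    have mi : (m.+1%:R * i = 1)%R by rewrite Hi mulfV // pnatr_eq0.
    rewrite !natrM; transitivity ((m.+1%:R - m.+1%:R * i) * t%:R - eps * (m.+1%:R * t%:R))%R.
      by ring.
    by rewrite mi -natr1; ring.
  have := leq_trans H1 (leq_add (leq_mul rich (leqnn _)) (leqnn _)).
  rewrite -(ler_nat R) !natrD (natrM _ #|L|) (natrM _ #|W|) (natrD _ (m.+1.-1 * t)) -HN /=.
  move: H2; rewrite mulrA mt => H2 H3.
  have HC : (16%:R * (C0 * (m.+1 * t))%:R <= d * N)%R.
    have : (16%:R * (C0 * (m.+1 * t).+1)%:R <= d * N)%R.
      rewrite [leRHS]mulrC -ler_pdivrMr //; exact: le_trans nN3.
    apply: le_trans; rewrite ler_pM2l // ler_nat leq_mul2l leqnSn orbT //.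
  have qh : (32%:R * q%:R <= d * h%:R)%R by move: hq; rewrite -natr1; lra.
  have e1 : (eps * (m.+1 * t)%:R * N <= d * h%:R / 32%:R * N)%R by rewrite ler_wpM2r // ltW.
  have e2 : (q%:R * N * 32%:R <= d * h%:R * N)%R.
    by rewrite mulrC mulrA ler_wpM2r // ltW.
  have e3 : (d * N <= h%:R * (d * N))%R.
    by rewrite ler_peMl // mulr_ge0 // ltW.
  rewrite -(ler_pM2r hR0); lra.
have rN : (#|rch|%:R * 16%:R <= d * N)%R.
  have : (16%:R * (C0 * (m.+1 * t).+1)%:R <= d * N)%R.
    rewrite [leRHS]mulrC -ler_pdivrMr //; exact: le_trans nN3.
  apply: le_trans; rewrite mulrC ler_pM2l // ler_nat.
  by apply: leq_trans rich _; exact: leq_pmulr.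
(* Vertices of [rch] have no such part and fall into class 0 by default; they belong to [X]. *)
pose cls v := odflt ord0 [pick i : 'I_m.+1 | deg e (A i) v < q].
exists cls.
pose X := rch :|: L.
have XW : X \subset W.
  by apply/subsetP => v; rewrite !inE -!andbA => /orP[/andP[]|/and3P[]].
have cX : (#|X|%:R * 16%:R <= 3%:R * (d * N))%R.
  have : (#|X|%:R <= #|rch|%:R + #|L|%:R :> R)%R.
    by rewrite -natrD ler_nat cardsU leq_subr.
  lra.
have typ v : v \in W :\: X -> deg e (A (cls v)) v < q /\
    (forall j, j < m.+1 -> j != cls v -> t <= deg e (A j) v + h).
  rewrite !inE negb_or => /andP[/andP[vr vL] vW]; move: vr vL.
  rewrite vW /= => vr; rewrite vr /= -ltnNge => vL.
  have vq : deg e (A (cls v)) v < q.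
    rewrite /cls; case: pickP => //= nov; case/negP: vr; apply/forallP => j.
    by rewrite leqNgt nov.
  split=> // j jm jv; move: vL; rewrite (bigD1 (cls v)) //= (bigD1 (Ordinal jm)) /=; last first.
    by rewrite -val_eqE.
  have : \sum_(k < m.+1 | (k != cls v) && (k != Ordinal jm)) deg e (A k) v <= m.-1 * t.
    rewrite (_ : m.-1 * t = \sum_(k < m.+1 | (k != cls v) && (k != Ordinal jm)) t).
      by apply: leq_sum => k _; rewrite -(At k) // deg_le_card.
    rewrite sum_nat_const; congr (_ * _).
    have /eqP := cardC1 (cls v); rewrite card_ord /= => /eqP {1}<-.
    rewrite [in LHS](cardD1 (Ordinal jm)) !inE -val_eqE jv add1n /=.
    by apply: eq_card => k; rewrite !inE andbC.
  have : m * t = t + m.-1 * t by rewrite -{1}(prednK m1).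
  move: (\sum_(k < _ | _) _) vq; clear; lia.
have small (k : 'I_m.+1) :
    ((vol e [set u in W :\: X | cls u == k])%:R <= c * N ^+ 2)%R.
  set U := [set u in _ | _].
  have UW : U \subset W by apply/subsetP => u; rewrite !inE => /andP[/andP[_ ->]].
  have cU : (#|U|%:R <= N)%R by rewrite HN ler_nat subset_leq_card.
  rewrite leNgt; apply/negP => big.
  have vU : ((vol e U)%:R <= #|U|%:R * N :> R)%R.
    rewrite HN -natrM ler_nat -sum_nat_const; apply: leq_sum => v _.
    by apply: leq_trans (deg_le_card _ _ _) _; exact: subset_leq_card.
  have nU : n1 <= #|U|.
    rewrite -(ler_nat R); apply: (@le_trans _ _ (c * N)%R).
      by rewrite mulrC -ler_pdivrMr //; exact: le_trans nN4.
    rewrite -(ler_pM2r N0) -mulrA -expr2; exact: le_trans (ltW big) vU.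
  apply: noK; apply: (@blowup_of_dense_class _ e W U m.+1 q t h k A) => //.
  - move=> v j; rewrite inE => /andP[/typ[_ H] /eqP kE] jm; rewrite -kE; exact: H.
  - apply: es1 => //; rewrite invr1 subrr add0r; apply: le_trans (ltW big).
    by rewrite ler_pM2l // lerXn2r ?nnegrE ?ler0n // ltW.
have := internal_le cls esym XW; rewrite (internal_vol _ (W :\: X)) -(ler_nat R) => /le_trans; apply.
rewrite natrD -muln2 !natrM natr_sum -HN.
have : (\sum_(k < m.+1) (vol e [set u in W :\: X | cls u == k])%:R <= d / 2%:R * N ^+ 2)%R.
  apply: le_trans (ler_sum _ (fun k _ => small k)) _.
  rewrite sumr_const card_ord -[leLHS]mulr_natl mulrA ler_wpM2r ?sqr_ge0 // /c.
  have : (m.+1%:R != 0 :> R)%R by rewrite pnatr_eq0.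
  by move: (m.+1%:R)%R => x x0; rewrite le_eqVlt; apply/orP; left; apply/eqP; field.
have : (#|X|%:R * 16%:R * N <= 3%:R * (d * N) * N)%R by rewrite ler_wpM2r // ltW.
have : (0 <= d * N * N)%R by rewrite !mulr_ge0 // ltW.
rewrite expr2; lra.
Qed.

End Stability.

(** Vertices of degree below about (1 - 1/m - E)|W| are peeled off. The assumed loss kE is much
    smaller than E, and by Erdős-Stone the remaining [W] has volume below (1 - 1/m + kE)|W|^2;
    together (1-k) n^2 <= (1+k) |W|^2, so few vertices were removed, and they are charged with all
    their pairs. *)
Lemma stability (R : realType) m q (d : R) : 1 < m -> (0 < d)%R ->
  exists2 eps : R, (0 < eps)%R & exists n0 : nat,
  forall (T : finType) (e : rel T), symmetric e -> irreflexive e -> n0 <= #|T| ->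
    ((1 - m%:R^-1 - eps) * #|T|%:R ^+ 2 <= (vol e [set: T])%:R :> R)%R ->
    ~ has_blowup e [set: T] m.+1 q ->
    exists f : T -> 'I_m, ((internal e [set: T] f)%:R <= d * #|T|%:R ^+ 2 :> R)%R.
Proof.
move=> m1 d0.
have d20 : (0 < d / 2%:R)%R by rewrite divr_gt0.
have [eps1 eps10 [n1 mind]] := stability_mindeg q m1 d20.
have [i Hi] : exists i : R, i = (m%:R^-1)%R by eexists.
have [i0 i2] : (0 < i)%R /\ (i <= 2%:R^-1)%R.
  by rewrite Hi invr_gt0 ltr0n (ltn_trans _ m1) // lef_pV2 ?posrE ?ltr0n ?(ltn_trans _ m1) // ler_nat.
pose E : R := Num.min (eps1 / 2%:R)%R (4%:R^-1)%R.
have E0 : (0 < E)%R by rewrite lt_min divr_gt0 // invr_gt0 ltr0n.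
have E4 : (E <= 4%:R^-1)%R by rewrite ge_min lexx orbT.
have E1 : (E <= eps1 / 2%:R)%R by rewrite ge_min lexx.
pose k : R := Num.min (d / 16%:R)%R (4%:R^-1)%R.
have k0 : (0 < k)%R by rewrite lt_min divr_gt0 // invr_gt0 ltr0n.
have k4 : (k <= 4%:R^-1)%R by rewrite ge_min lexx orbT.
have k1 : (k <= d / 16%:R)%R by rewrite ge_min lexx.
have kE0 : (0 < k * E)%R by rewrite mulr_gt0.
have [n2 es] := erdos_stone q (ltnW m1) kE0.
have [n3 Hn3] := exists_nat_ge (2%:R / E * (n1%:R + n2%:R + E^-1))%R.
exists (k * E)%R => //; exists n3.+1 => T e esym eirr nT vT noK.
rewrite -Hi in vT mind es.
pose b : R := (1 - i - E)%R.
have b0 : (0 <= b)%R by rewrite /b; lra.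
have [W [_ gain md]] := peel esym eirr (fun n => b * n%:R ^+ 2)%R [set: T].
rewrite cardsT in gain.
have [N HN] : exists N : R, N = (#|T|%:R)%R by eexists.
have [N' HN'] : exists N' : R, N' = (#|W|%:R)%R by eexists.
rewrite -HN -?HN' in vT gain *.
have N0 : (0 < N)%R by rewrite HN ltr0n; apply: leq_trans nT.
have nN : (n3%:R <= N)%R by rewrite HN ler_nat ltnW.
have NN' : (N' <= N)%R by rewrite HN HN' ler_nat max_card.
have N'0 : (0 <= N')%R by rewrite HN' ler0n.
have vW : ((vol e W)%:R <= N' ^+ 2)%R.
  rewrite HN' -natrX ler_nat -mulnn -sum_nat_const; apply: leq_sum => v _.
  exact: deg_le_card.
have {}gain : ((1 - k) * E * N ^+ 2 <= (vol e W)%:R - b * N' ^+ 2)%R.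
  apply: le_trans gain; rewrite (_ : (1 - k) * E * N ^+ 2 = (1 - i - k * E) * N ^+ 2 - b * N ^+ 2)%R.
    lra.
  by rewrite /b; ring.
have sN (x : R) : (x * N ^+ 2 <= N' ^+ 2)%R -> (x * N <= N')%R.
  move=> H; rewrite -(ler_pM2r N0) -mulrA -expr2; apply: le_trans H _.
  by rewrite expr2 ler_wpM2l.
have N'big : (n1%:R + n2%:R + E^-1 <= N')%R.
  have : (E / 2%:R * N <= N')%R.
    apply: sN; apply: le_trans (_ : (1 - k) * E * N ^+ 2 <= _)%R.
      rewrite ler_wpM2r ?sqr_ge0 //; nra.
    have : (0 <= b * N' ^+ 2)%R by rewrite mulr_ge0 ?sqr_ge0.
    lra.
  apply: le_trans; apply: le_trans (_ : E / 2%:R * n3%:R <= _)%R.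
    rewrite [leLHS](_ : _ = E / 2%:R * (2%:R / E * (n1%:R + n2%:R + E^-1)))%R.
      by rewrite ler_wpM2l // divr_ge0 // ltW.
    by field; rewrite gt_eqF.
  by rewrite ler_wpM2l // divr_ge0 // ltW.
have Ei0 : (0 < E^-1)%R by rewrite invr_gt0.
have n1W : n1 <= #|W|.
  rewrite -(ler_nat R) -HN'; have : (0 <= n2%:R :> R)%R by rewrite ler0n.
  lra.
have n2W : n2 <= #|W|.
  rewrite -(ler_nat R) -HN'; have : (0 <= n1%:R :> R)%R by rewrite ler0n.
  lra.
have noKW : ~ has_blowup e W m.+1 q by move=> H; apply: noK; apply: has_blowup_sub H; exact: subsetT.
have vW' : ((vol e W)%:R < (1 - i + k * E) * N' ^+ 2)%R.
  by rewrite ltNge; apply/negP => H; apply: noKW; apply: es => //; rewrite -HN'.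
have N'N : ((1 - 2%:R * k) * N <= N')%R.
  apply: sN; have H : ((1 - k) * N ^+ 2 <= (1 + k) * N' ^+ 2)%R.
    rewrite -(ler_pM2l E0); move: gain vW'; rewrite /b; lra.
  have N20 : (0 <= N ^+ 2)%R by rewrite sqr_ge0.
  rewrite -(ler_pM2l (_ : 0 < 1 + k)%R); last by lra.
  apply: le_trans H; rewrite mulrA ler_wpM2r //; nra.
have [v vW1|f Hf] := mind T e W esym eirr n1W _ noKW.
  have := md v vW1.
  have W0 : 0 < #|W| by apply/card_gt0P; exists v.
  have -> : (#|W|.-1%:R = N' - 1 :> R)%R by rewrite -subn1 natrB // HN'.
  have : (1 <= E * N')%R.
    rewrite -(mulfV (lt0r_neq0 E0)) ler_pM2l //.
    have : (0 <= n1%:R :> R)%R by rewrite ler0n.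
    have : (0 <= n2%:R :> R)%R by rewrite ler0n.
    lra.
  rewrite -HN' => H1 H2.
  have H3 : ((b - E) * N' <= (deg e W v)%:R)%R.
    move: H2; rewrite /b; nra.
  apply: le_trans H3; rewrite ler_wpM2r // /b; lra.
exists f.
have := @internal_le T e [set: T] (~: W) m f esym (subsetT _).
have -> : [set: T] :\: ~: W = W by rewrite setTD setCK.
rewrite cardsT -(ler_nat R) => /le_trans; apply.
rewrite natrD -muln2 !natrM -HN.
have -> : (#|~: W|%:R = N - N' :> R)%R.
  by rewrite HN HN' -(cardsC W) natrD addrAC subrr add0r.
have H1 : ((N - N') * N <= 2%:R * k * N * N)%R by apply: ler_wpM2r; [exact: ltW | lra].
have H2 : (2%:R * k * N * N <= d / 8%:R * N ^+ 2)%R.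
  rewrite -mulrA -expr2 ler_wpM2r ?sqr_ge0 //; lra.
have H3 : (d / 2%:R * N' ^+ 2 <= d / 2%:R * N ^+ 2)%R.
  by rewrite ler_pM2l // lerXn2r ?nnegrE // ltW.
rewrite -HN' in Hf.
have : (0 <= d * N ^+ 2)%R by rewrite mulr_ge0 ?sqr_ge0 // ltW.
lra.
Qed.

(** * Forests *)

Definition acyclic (V : eqType) (J : rel V) : Prop :=
  forall c : seq V, 2 < size c -> ~ ucycle J c.

Section Forests.
Variables (V : finType) (J : rel V).
Hypotheses (Jsym : symmetric J) (Jirr : irreflexive J) (Jac : acyclic J).

(* A path inside [A] can be extended at its head as long as vertices of [A] have
   two neighbours in [A]. *)
Lemma acyclic_leaf (A : {set V}) : A != set0 ->
  exists2 v, v \in A & deg J A v <= 1.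
Proof.
case/set0Pn => a aA.
case: (boolP [exists v in A, deg J A v <= 1]) => [/existsP[v /andP[vA v1]]|].
  by exists v.
move=> noleaf; exfalso.
have deg2 v : v \in A -> 1 < deg J A v.
  move=> vA; rewrite ltnNge; apply/negP => v1; case/negP: noleaf.
  by apply/existsP; exists v; rewrite vA.
have long n : exists x p, [/\ size p = n, uniq (x :: p), path J x p &
    {subset x :: p <= A}].
  elim: n => [|n [x [p [sp up pp pA]]]].
    by exists a, [::]; split=> // u; rewrite inE => /eqP->.
  have xA : x \in A by apply: pA; rewrite inE eqxx.
  have : 0 < #|[set u in A | J x u] :\ head x p|.
    have := deg2 x xA; rewrite /deg (cardsD1 (head x p)).
    by case: (_ \in _); rewrite ?add1n ?add0n // => /ltnW.
  case/card_gt0P => z; rewrite !inE => /and3P[zh zA Jxz].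
  case: (boolP (z \in x :: p)) => [zp|zp]; last first.
    exists z, (x :: p); split=> //=; rewrite ?sp //.
    - by rewrite zp.
    - by rewrite Jsym Jxz.
    - by move=> u; rewrite inE => /predU1P[->|/pA].
  exfalso; move: zp; rewrite inE; case: eqP => [zx|_ /= zp].
    by rewrite zx Jirr in Jxz.
  move: zh up pp; case/splitPr: p / zp sp pA => p1 p2 sp pA zh up pp.
  have p1n : p1 != [::] by case: p1 zh {sp pA up pp} => //=; rewrite eqxx.
  apply: (Jac (c := x :: rcons p1 z)).
    by rewrite /= size_rcons !ltnS lt0n size_eq0.
  rewrite /ucycle /= rcons_path last_rcons Jsym Jxz andbT; apply/andP; split.
    by move: pp; rewrite -cat_rcons cat_path => /andP[].
  have : subseq (x :: rcons p1 z) (x :: p1 ++ z :: p2).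
    by rewrite /= eqxx -cat_rcons prefix_subseq.
  by move/subseq_uniq => /(_ up).
have [x [p [sp up pp pA]]] := long #|A|.
have : size (x :: p) <= #|A|.
  by rewrite -(card_uniqP up); apply: subset_leq_card; apply/subsetP.
by rewrite /= sp ltnn.
Qed.

(** Vertices are placed in the reverse order of leaf removal: a new vertex has at most one placed
    neighbour, and the image of that one has [#|V|] neighbours in [W], of which fewer than [#|V|]
    are occupied. *)
Lemma forest_embedding (T : finType) (e : rel T) (W : {set T}) w0 :
  symmetric e -> w0 \in W -> (forall v, v \in W -> #|V| <= deg e W v) ->
  exists g : V -> T, [/\ injective g, forall a, g a \in W &
    forall a b, J a b -> e (g a) (g b)].
Proof.
move=> esym w0W Wdeg.
suff H n (A : {set V}) : #|A| = n -> exists g : V -> T,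
    [/\ {in A &, injective g}, forall a, a \in A -> g a \in W &
      forall a b, a \in A -> b \in A -> J a b -> e (g a) (g b)].
  have [g [g1 g2 g3]] := H _ [set: V] erefl.
  by exists g; split=> [a b|a|a b]; [apply: g1|apply: g2|apply: g3]; rewrite inE.
elim: n A => [|n IH] A cA.
  exists (fun=> w0); have -> : A = set0 by apply/eqP; rewrite -cards_eq0 cA.
  by split=> [a b|a|a b]; rewrite inE.
have [v vA v1] : exists2 v, v \in A & deg J A v <= 1.
  by apply: acyclic_leaf; rewrite -card_gt0 cA.
have cA' : #|A :\ v| = n by move: cA; rewrite (cardsD1 v) vA add1n => -[].
have [g [g1 g2 g3]] := IH _ cA'.
(* If v has no placed neighbour, [w0] serves as the anchor, only to have a vertex of large degree
   from which to choose a free one. *)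
pose b0 := if [pick u in A :\ v | J v u] is Some u then g u else w0.
have b0W : b0 \in W by rewrite /b0; case: pickP => // u /andP[uA _]; exact: g2.
have b0J u : u \in A :\ v -> J v u -> b0 = g u.
  move=> uA Jvu; rewrite /b0; case: pickP => [u' /andP[u'A Jvu']|/(_ u)]; last first.
    by rewrite uA Jvu.
  congr (g _); apply/eqP; move: v1; rewrite leqNgt; apply: contraNT => uu'.
  rewrite /deg; apply/card_gt1P; exists u', u; split=> //.
    by rewrite inE Jvu' andbT; case/setD1P: u'A.
  by rewrite inE Jvu andbT; case/setD1P: uA.
have : 0 < #|[set u in W | e b0 u] :\: g @: (A :\ v)|.
  rewrite cardsD subn_gt0; apply: leq_ltn_trans (subset_leq_card (subsetIr _ _)) _.
  apply: leq_ltn_trans (leq_imset_card _ _) _; apply: leq_trans (Wdeg _ b0W).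
  by rewrite cA' -cA max_card.
case/card_gt0P => w; rewrite !inE => /and3P[wg wW ebw].
have wNg u : u \in A -> u != v -> g u != w.
  move=> uA uv; apply: contraNneq wg => <-; apply: imset_f.
  by rewrite !inE uv.
exists (fun a => if a == v then w else g a); split.
- move=> a b aA bA; case: eqP => [->|/eqP av]; case: eqP => [->|/eqP bv] //.
  + by move/eqP; rewrite eq_sym (negbTE (wNg b bA bv)).
  + by move/eqP; rewrite (negbTE (wNg a aA av)).
  + by apply: g1; rewrite !inE ?av ?bv.
- by move=> a aA; case: eqP => [//|/eqP av]; apply: g2; rewrite !inE av.
- move=> a b aA bA; case: eqP => [->|/eqP av]; case: eqP => [->|/eqP bv].
  + by rewrite Jirr.
  + by move=> Jvb; rewrite esym -(b0J b) // !inE bv.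
  + by rewrite Jsym => Jva; rewrite -(b0J a) // !inE av.
  + by apply: g3; rewrite !inE ?av ?bv.
Qed.

(** Average degree above 2|V| yields a nonempty subgraph of minimum degree at least |V|: peeling
    with a linear weight whose increments are 2|V|. *)
Lemma forest_in_dense (R : realType) (T : finType) (e : rel T) (W : {set T}) :
  symmetric e -> irreflexive e -> (#|V| * #|W|).*2 < vol e W ->
  exists g : V -> T, [/\ injective g, forall a, g a \in W &
    forall a b, J a b -> e (g a) (g b)].
Proof.
move=> esym eirr dense.
have [W' [W'W gain md]] := @peel T e esym eirr R (fun n => (#|V| * n).*2%:R)%R W.
have : (0 < (vol e W')%:R - (#|V| * #|W'|).*2%:R :> R)%R.
  by apply: lt_le_trans gain; rewrite subr_gt0 ltr_nat.
rewrite subr_gt0 ltr_nat => vW'.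
have [w0 w0W] : exists w0, w0 \in W'.
  apply/set0Pn; apply: contraTneq vW' => ->; by rewrite /vol big_set0.
have [v /md|g [g1 g2 g3]] := forest_embedding (e := e) (W := W') esym w0W _.
  have cW : #|W'| = #|W'|.-1.+1 by rewrite prednK //; apply/card_gt0P; exists w0.
  rewrite {1}cW mulnS doubleD natrD addrK -muln2 natrM ler_pM2r ?ltr0n //.
  by rewrite ler_nat.
by exists g; split=> // a; exact: (subsetP W'W).
Qed.

Lemma forest_in_biclique (T : finType) (e : rel T) (A B : {set T}) :
  symmetric e -> 0 < #|V| -> #|V| <= #|A| -> #|V| <= #|B| ->
  (forall u v, u \in A -> v \in B -> e u v) ->
  exists g : V -> T, [/\ injective g, forall a, g a \in A :|: B &
    forall a b, J a b -> e (g a) (g b)].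
Proof.
move=> esym V0 VA VB eAB.
have /card_gt0P[w0 w0A] : 0 < #|A| by apply: leq_trans VA.
apply: (@forest_embedding _ _ _ w0) => //; first by rewrite inE w0A.
move=> v; rewrite inE => /orP[vA|vB].
  apply: leq_trans VB _; apply: subset_leq_card; apply/subsetP => u uB.
  by rewrite !inE uB orbT eAB.
apply: leq_trans VA _; apply: subset_leq_card; apply/subsetP => u uA.
by rewrite !inE uA esym eAB.
Qed.

End Forests.

(** * Maximum cuts *)

Definition class (T : finType) m (f : T -> 'I_m) (k : nat) : {set T} :=
  [set u | f u == k :> nat].

Definition missing (T : finType) (e : rel T) m (f : T -> 'I_m) (v : T) : nat :=
  #|[set u | (f u != f v) && ~~ e v u]|.

Section Cuts.
Variables (T : finType) (e : rel T) (m : nat).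
Hypotheses (esym : symmetric e) (eirr : irreflexive e).
Implicit Types f : T -> 'I_m.

Lemma internal_setT f :
  internal e [set: T] f = \sum_v deg e (class f (f v)) v.
Proof.
apply: eq_big => [v|v _]; first by rewrite inE.
by congr deg; apply/setP => u; rewrite !inE.
Qed.

Lemma internal_rem f v :
  internal e [set: T] f =
  internal e ([set: T] :\ v) f + (deg e (class f (f v)) v).*2.
Proof.
rewrite !internalE (vol_rem (same_class_sym f esym) (same_class_irr f eirr) (in_setT v)).
rewrite deg_same_class; do 3 f_equal.
by apply/setP => u; rewrite !inE.
Qed.

(** Fewest inner edges means largest cut. Moving v alone to class j changes [internal] by twice the
    difference of its degrees into the two classes, so minimality gives the inequality. *)
Lemma max_cut f0 : exists f,
  internal e [set: T] f <= internal e [set: T] f0 /\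
  forall v (j : 'I_m), deg e (class f (f v)) v <= deg e (class f j) v.
Proof.
have [f _ fmin] := @arg_minnP _ [ffun v => f0 v] predT
  (fun f : {ffun T -> 'I_m} => internal e [set: T] f) isT.
exists f; split.
  apply: leq_trans (fmin [ffun v => f0 v] isT) _.
  by rewrite !internal_setT; apply: leq_sum => v _; apply: subset_leq_card;
    apply/subsetP => u; rewrite !inE !ffunE.
move=> v j; pose f' := [ffun u => if u == v then j else f u].
have := fmin f' isT; rewrite /= (internal_rem f v) (internal_rem f' v).
have -> : internal e ([set: T] :\ v) f' = internal e ([set: T] :\ v) f.
  apply: eq_bigr => u; rewrite !inE andbT => uv; congr deg; apply/setP => w.
  by rewrite !inE !ffunE (negbTE uv); case: (eqVneq w v).
rewrite leq_add2l leq_double => /leq_trans; apply; apply: subset_leq_card.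
apply/subsetP => u; rewrite !inE !ffunE eqxx; case: (eqVneq u v) => [->|//].
by rewrite eirr !andbF.
Qed.

Lemma degree_balance f v :
  deg e [set: T] v + missing e f v + #|class f (f v)| =
  #|T| + deg e (class f (f v)) v.
Proof.
rewrite /missing !degE -!sum1_card.
rewrite [\sum_(u in class _ _) 1]big_mkcond [\sum_(u in [set u | _]) 1]big_mkcond /=.
rewrite [X in _ = _ + X]big_mkcond [X in X + _ + _]big_mkcond -!big_split /=.
apply: eq_bigr => u _; rewrite !inE val_eqE.
by case: (f u == f v); case: (e v u).
Qed.

Lemma sum_card_class f : \sum_(i < m) #|class f i| = #|T|.
Proof.
rewrite -sum1_card (partition_big f predT) //=; apply: eq_bigr => i _.
by rewrite -sum1_card; apply: eq_bigl => u; rewrite !inE val_eqE.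
Qed.

(** The sum of [degree_balance] over all v. Being exact, it yields the volume of a blow-up when
    inner edges and missing pairs vanish, and, by subtraction, the comparison of any graph with the
    blow-up on the same classes. *)
Lemma cut_balance f :
  vol e [set: T] + \sum_v missing e f v + \sum_(i < m) #|class f i| ^ 2 =
  #|T| ^ 2 + internal e [set: T] f.
Proof.
have -> : \sum_(i < m) #|class f i| ^ 2 = \sum_v #|class f (f v)|.
  rewrite [RHS](partition_big f predT) //=; apply: eq_bigr => i _.
  rewrite -mulnn -sum_nat_const; apply: eq_big => [v|v].
    by rewrite !inE val_eqE.
  by rewrite inE => /eqP->.
have -> : vol e [set: T] = \sum_v deg e [set: T] v by apply: eq_bigl => v; rewrite inE.
rewrite internal_setT -mulnn -sum_nat_const -!big_split /=.
by apply: eq_bigr => v _; exact: degree_balance.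
Qed.

(** Parts are chosen one at a time: the at most mq vertices chosen so far each miss at most D
    vertices of the next [W k], so q common neighbours remain in it. *)
Lemma greedy_blowup f q D (W : nat -> {set T}) :
  (forall k, k < m -> W k \subset class f k) ->
  (forall k v, k < m -> v \in W k -> missing e f v <= D) ->
  (forall k, k < m -> m * q * D + q <= #|W k|) ->
  exists A : nat -> {set T},
    [/\ forall k, k < m -> A k \subset W k, forall k, k < m -> #|A k| = q &
      forall i j, i < m -> j < m -> i != j ->
        forall u v, u \in A i -> v \in A j -> e u v].
Proof.
move=> Wf WD Wq.
suff H n : n <= m -> exists A : nat -> {set T},
    [/\ forall k, k < n -> A k \subset W k, forall k, k < n -> #|A k| = q &
      forall i j, i < n -> j < n -> i != j ->
        forall u v, u \in A i -> v \in A j -> e u v] by exact: H.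
elim: n => [|n IH] nm; first by exists (fun=> set0).
have [A [AW Aq Ae]] := IH (ltnW nm).
pose Z := \bigcup_(i < n) A i.
have cZ : #|Z| <= m * q.
  apply: leq_trans (leq_mul (ltnW nm) (leqnn q)).
  apply: leq_trans (card_bigcup_le _ _) _.
  by rewrite (eq_bigr (fun=> q)) => [|i _]; rewrite ?Aq // sum_nat_const card_ord.
have Zdeg z : z \in Z -> #|W n| <= deg e (W n) z + D.
  case/bigcupP => i _ zA.
  have im : i < m by apply: ltn_trans nm.
  have zW : z \in W i by apply: (subsetP (AW i (ltn_ord i))).
  apply: leq_trans (leq_add (leqnn _) (WD i z im zW)).
  rewrite -(cardsID [set u | e z u] (W n)) leq_add //; apply: subset_leq_card.
    by apply/subsetP => u; rewrite !inE.
  apply/subsetP => u; rewrite !inE => /andP[-> uW]; rewrite andbT -val_eqE /=.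
  have /subsetP/(_ u uW) := Wf n nm; rewrite inE => /eqP->.
  have /subsetP/(_ z zW) := Wf i im; rewrite inE => /eqP->.
  by rewrite neq_ltn ltn_ord orbT.
have : q <= #|common_nbrs e (W n) Z|.
  have := leq_trans (card_common_nbrs Zdeg) (leq_add (leqnn _) (leq_mul cZ (leqnn D))).
  by move/(leq_trans (Wq n nm)); rewrite addnC leq_add2r.
case/subset_of_card => B BN Bq.
have BW u : u \in B -> u \in W n by move/(subsetP BN)/common_nbrsP => -[].
have BA i u v : i < n -> u \in A i -> v \in B -> e u v.
  move=> iN uA /(subsetP BN)/common_nbrsP[_]; apply.
  by apply/bigcupP; exists (Ordinal iN).
pose A' k := if k == n then B else A k.
have A'n : A' n = B by rewrite /A' eqxx.
have casek k : k < n.+1 -> k = n \/ k < n /\ A' k = A k.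
  rewrite ltnS leq_eqVlt => /predU1P[->|kn]; first by left.
  by right; rewrite /A' ltn_eqF.
exists A'; split.
- move=> k /casek[->|[kn ->]]; last exact: AW.
  by rewrite A'n; apply/subsetP.
- by move=> k /casek[->|[kn ->]]; rewrite ?A'n // Aq.
- move=> i j /casek[->|[iN ->]] /casek[->|[jN ->]]; rewrite ?eqxx ?A'n //.
  + by move=> _ u v uB vA; rewrite esym; apply: (BA j).
  + by move=> _ u v; apply: BA.
  + exact: Ae.
Qed.

End Cuts.

Section RealCuts.
Variables (R : realType) (T : finType) (e : rel T) (m : nat).
Hypotheses (esym : symmetric e) (eirr : irreflexive e) (m0 : 0 < m).
Implicit Types f : T -> 'I_m.

Lemma card_exceeding (w : T -> nat) (x : R) :
  (#|[set v | (x < (w v)%:R)%R]|%:R * x <= (\sum_v w v)%:R)%R.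
Proof.
set X := [set v | _].
rewrite (bigID (mem X)) /= natrD mulr_natl -sumr_const natr_sum.
apply: ler_wpDr; first by rewrite ler0n.
by apply: ler_sum => v; rewrite inE => /ltW.
Qed.

(** With n the order, Markov's inequality shows that at most rho n/4 vertices miss more than x = rho
    n/(4mq). Without them every [W k] keeps 3 rho n/4 vertices, and the greedy choice with D the
    integer part of x consumes mqD + q <= rho n/2. *)
Lemma big_blowup f q (rho : R) (W : nat -> {set T}) : 0 < q -> (0 < rho)%R ->
  (16%:R * (m * q)%:R * (\sum_v missing e f v)%:R <= rho ^+ 2 * #|T|%:R ^+ 2)%R ->
  (4%:R * q%:R <= rho * #|T|%:R)%R ->
  (forall k, k < m -> W k \subset class f k) ->
  (forall k, k < m -> (rho * #|T|%:R <= #|W k|%:R)%R) ->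
  exists A : nat -> {set T},
    [/\ forall k, k < m -> A k \subset W k, forall k, k < m -> #|A k| = q &
      forall i j, i < m -> j < m -> i != j ->
        forall u v, u \in A i -> v \in A j -> e u v].
Proof.
move=> q0 rho0 HM Hq WC Wbig.
have [N HN] : exists N : R, N = (#|T|%:R)%R by eexists.
have [K HK] : exists K : R, K = ((m * q)%:R)%R by eexists.
rewrite -HN -HK in HM Hq *.
have K0 : (0 < K)%R by rewrite HK ltr0n muln_gt0 m0.
have q1 : (1 <= q%:R :> R)%R by rewrite ler1n.
have rN0 : (0 < rho * N)%R by lra.
pose x : R := (rho * N / (4%:R * K))%R.
have Kx : (K * x = rho * N / 4%:R)%R by rewrite /x; field; rewrite gt_eqF.
have x0 : (0 < x)%R by rewrite divr_gt0 // mulr_gt0.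
pose X := [set v | (x < (missing e f v)%:R)%R].
have cX : (#|X|%:R * 4%:R <= rho * N)%R.
  rewrite -(ler_pM2r x0); apply: (@le_trans _ _ (4%:R * (\sum_v missing e f v)%:R)%R).
    by rewrite mulrAC mulrC ler_wpM2l ?card_exceeding.
  rewrite -(ler_pM2l K0) (_ : K * (rho * N * x) = (rho * N) * (K * x))%R; last by ring.
  rewrite Kx; move: HM; lra.
pose D := Num.truncn x.
have Dx : (D%:R <= x)%R by rewrite truncn_le ltW.
have [k km|k v km|k km|A [AW Aq Ae]] :=
    @greedy_blowup T e m esym f q D (fun k => W k :\: X).
- by apply: subset_trans (WC k km); exact: subsetDl.
- rewrite !inE -leNgt => /andP[vx _].
  by rewrite truncn_ge_nat // ltW.
- rewrite -(ler_nat R) natrD natrM -HK.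
  have : (#|W k|%:R <= #|W k :\: X|%:R + #|X|%:R :> R)%R.
    by rewrite -natrD ler_nat -(cardsID X) addnC leq_add2l subset_leq_card // subsetIr.
  have := Wbig k km; rewrite -HN.
  have : (K * D%:R <= K * x)%R by rewrite ler_pM2l.
  rewrite Kx; lra.
- exists A; split=> // k km.
  by apply: subset_trans (AW k km) (subsetDl _ _).
Qed.

(** In [cut_balance] the sum of squared class sizes is n^2/m plus the sum of squared deviations from
    n/m. The hypotheses leave at most 2 d n^2 for the missing pairs and the deviations together; the
    bound on d then keeps each class above n/(2m). *)
Lemma class_bounds f (d : R) :
  ((1 - m%:R^-1 - d) * #|T|%:R ^+ 2 <= (vol e [set: T])%:R)%R ->
  ((internal e [set: T] f)%:R <= d * #|T|%:R ^+ 2)%R ->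
  (8%:R * m%:R ^+ 2 * d <= 1)%R ->
  ((\sum_v missing e f v)%:R <= 2%:R * d * #|T|%:R ^+ 2)%R /\
  forall k, k < m -> (#|T|%:R <= 2%:R * m%:R * #|class f k|%:R :> R)%R.
Proof.
move=> Hv Hi Hd.
have := @cut_balance T e m f; move/(congr1 (fun n => n%:R : R)%R).
rewrite !natrD [X in (_ + X = _)%R]natr_sum natrX.
rewrite [X in (_ + X = _)%R](eq_bigr (fun i : 'I_m => (#|class f i|%:R ^+ 2)%R)); last first.
  by move=> i _; rewrite natrX.
have [N HN] : exists N : R, N = (#|T|%:R)%R by eexists.
have [M HM] : exists M : R, M = (m%:R)%R by eexists.
have S1 : (\sum_(i < m) #|class f i|%:R = N)%R by rewrite HN -(sum_card_class f) natr_sum.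
rewrite -HN -HM in Hv Hi Hd *.
have N0 : (0 <= N)%R by rewrite HN.
have M0 : (0 < M)%R by rewrite HM ltr0n.
pose x (k : nat) := (#|class f k|%:R : R)%R; move=> S2.
have var : (\sum_(i < m) (x i - N / M) ^+ 2 = \sum_(i < m) (x i) ^+ 2 - N ^+ 2 / M)%R.
  transitivity (\sum_(i < m) x i ^+ 2 - 2%:R * (N / M) * \sum_(i < m) x i +
      \sum_(i < m) (N / M) ^+ 2)%R.
    by rewrite mulr_sumr -sumrB -big_split; apply: eq_bigr => i _ /=; ring.
  rewrite S1 sumr_const card_ord -[X in (_ + X = _)%R]mulr_natl -HM.
  by field; rewrite gt_eqF.
have var0 : (0 <= \sum_(i < m) (x i - N / M) ^+ 2)%R.
  by apply: sumr_ge0 => i _; exact: sqr_ge0.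
have miss0 : (0 <= (\sum_v missing e f v)%:R :> R)%R by [].
rewrite mulrBl mulrBl mul1r mulrC in Hv.
split; first by lra.
move=> k km; have : ((x k - N / M) ^+ 2 <= 2%:R * d * N ^+ 2)%R.
  apply: (@le_trans _ _ (\sum_(i < m) (x i - N / M) ^+ 2)%R); last by lra.
  rewrite (bigD1 (Ordinal km)) //= lerDl; apply: sumr_ge0 => i _; exact: sqr_ge0.
move=> H; rewrite -/(x k) leNgt; apply/negP => small.
have : (N ^+ 2 < 4%:R * M ^+ 2 * (x k - N / M) ^+ 2)%R.
  have -> : (4%:R * M ^+ 2 * (x k - N / M) ^+ 2 = (2%:R * N - 2%:R * M * x k) ^+ 2)%R.
    by field; rewrite gt_eqF.
  by rewrite ltrXn2r ?nnegrE //; lra.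
rewrite ltNge => /negP; apply.
apply: (@le_trans _ _ (4%:R * M ^+ 2 * (2%:R * d * N ^+ 2))%R).
  by rewrite ler_wpM2l // mulr_ge0 // sqr_ge0.
rewrite (_ : _ * _ = 8%:R * M ^+ 2 * d * N ^+ 2)%R; last by ring.
by rewrite -[leRHS]mul1r ler_wpM2r // sqr_ge0.
Qed.

End RealCuts.

(** * Common neighbourhoods in several classes at once *)

(** Induction on the number of classes. Among L vertices of [Y], double counting gives linearly many
    u in the last class with at least s neighbours, s being the size the induction needs; by
    pigeonhole linearly many u share the same trace [Z]. The induction continues inside [Z], and
    passing to a subset of [Z] can only enlarge the common neighbourhood already found. *)
Lemma rich_common (R : realType) (m q : nat) (g : R) : (0 < g)%R ->
  exists2 c : R, (0 < c)%R & exists L : nat,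
  forall (T : finType) (e : rel T) (V : nat -> {set T}) (Y : {set T}), symmetric e ->
    L <= #|Y| ->
    (forall v k, v \in Y -> k < m -> (g * #|T|%:R <= (deg e (V k) v)%:R)%R) ->
    exists Y0 : {set T}, [/\ Y0 \subset Y, q <= #|Y0| &
      forall k, k < m -> (c * #|T|%:R <= #|common_nbrs e (V k) Y0|%:R)%R].
Proof.
move=> g0; elim: m => [|m [c c0 [s IH]]].
  by exists 1%R => //; exists q => T e V Y _ qY _; exists Y.
have [L HL] := exists_nat_ge ((2%:R * s%:R + 1) / g)%R.
have gL : (2%:R * s%:R + 1 <= g * L%:R)%R by rewrite [leRHS]mulrC -ler_pdivrMr.
pose P : R := ((2 ^ L)%:R)%R.
have P0 : (0 < P)%R by rewrite ltr0n expn_gt0.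
exists (Num.min c (g / (2%:R * P))%R).
  by rewrite lt_min c0 divr_gt0 // mulr_gt0.
exists L => T e V Y esym LY Ydeg.
have [Y1 Y1Y cY1] := subset_of_card LY.
have s0 : (0 <= s%:R :> R)%R by [].
have L0 : 0 < L.
  by rewrite -(ltr0n R) -(pmulr_rgt0 _ g0); lra.
have [N HN] : exists N : R, N = (#|T|%:R)%R by eexists.
have N0 : (0 < N)%R.
  rewrite HN ltr0n; apply: leq_trans (max_card (mem Y)); exact: leq_trans LY.
pose U := [set u in V m | s <= deg e Y1 u].
have cU : (g * N <= 2%:R * #|U|%:R)%R.
  have H1 : (L%:R * (g * N) <= (\sum_(u in V m) deg e Y1 u)%:R)%R.
    rewrite -sum_deg_exchange // natr_sum mulr_natl -cY1 -sumr_const.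
    by apply: ler_sum => v vY; rewrite HN Ydeg // (subsetP Y1Y).
  have H2 : \sum_(u in V m) deg e Y1 u <= #|U| * L + s * #|T|.
    apply: (@leq_trans (\sum_(u in V m) ((u \in U) * L + s))).
      apply: leq_sum => u uV; rewrite inE uV /=; case: (leqP s (deg e Y1 u)) => [_|/ltnW //].
      by rewrite mul1n -cY1 (leq_trans (deg_le_card _ _ _)) ?leq_addr.
    rewrite big_split /= sum_nat_const leq_add //.
      rewrite -big_distrl /= leq_mul2r -sum1_card big_mkcond [leqRHS]big_mkcond /=.
      by apply/orP; right; apply: leq_sum => u _; case: ifP => // _; case: (u \in U).
    by rewrite mulnC leq_mul2l max_card orbT.
  move: H2; rewrite -(ler_nat R) natrD !natrM -HN => H2.
  have L0' : (0 < L%:R :> R)%R by rewrite ltr0n.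
  rewrite -(ler_pM2l L0').
  have : ((2%:R * s%:R + 1) * N <= g * L%:R * N)%R by rewrite ler_wpM2r // ltW.
  lra.
have [Z ZY1 HZ] := pigeonhole_trace e U Y1.
set F := [set v in U | _] in HZ.
have U0 : 0 < #|U|.
  by rewrite -(ltr0n R) -(pmulr_rgt0 _ (_ : 0 < 2%:R)%R) // (lt_le_trans _ cU) // mulr_gt0.
have F0 : 0 < #|F| by have := leq_trans U0 HZ; rewrite muln_gt0 => /andP[].
have sZ : s <= #|Z|.
  case/card_gt0P: F0 => u; rewrite !inE => /andP[/andP[_ su] /eqP <-].
  exact: su.
have [|Y0 [Y0Z qY0 HY0]] := IH T e V Z esym sZ.
  by move=> v k vZ km; apply: Ydeg; [apply/(subsetP Y1Y)/(subsetP ZY1) | exact: ltnW].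
exists Y0; split=> //.
  exact: subset_trans Y0Z (subset_trans ZY1 Y1Y).
move=> k; rewrite ltnS leq_eqVlt => /predU1P[->|km]; last first.
  by apply: le_trans (HY0 k km); rewrite ler_wpM2r // ge_min lexx.
apply: (@le_trans _ _ (#|F|%:R)%R); last first.
  rewrite ler_nat; apply: subset_leq_card; apply/subsetP => u.
  rewrite !inE -andbA => /and3P[uV _ /eqP ZE]; rewrite uV /=; apply/forallP => z.
  apply/implyP => /(subsetP Y0Z); rewrite -ZE inE esym => /andP[_ ->] //.
apply: (@le_trans _ _ (g / (2%:R * P) * N)%R).
  by rewrite -HN; apply: ler_wpM2r; [exact: ltW | rewrite ge_min lexx orbT].
have : (#|U|%:R <= #|F|%:R * P)%R by rewrite /P -natrM ler_nat -cY1.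
rewrite mulrAC ler_pdivrMr ?mulr_gt0 //; lra.
Qed.

(** * Linear stability *)

(** K_m^q with [J] placed in part j, as a subgraph that need not be induced. The set [A j] is
    ignored: keeping the index j free, instead of renumbering m-1 parts, accepts the output of
    [big_blowup] as it is. *)
Definition has_pattern (T : finType) (e : rel T) m q (J : rel 'I_q) : Prop :=
  exists (j : nat) (A : nat -> {set T}) (g : 'I_q -> T),
    [/\ j < m, injective g, forall a b, J a b -> e (g a) (g b) &
      [/\ forall k, k < m -> k != j -> q <= #|A k|,
          forall a k u, k < m -> k != j -> u \in A k -> e (g a) u &
          forall k l, k < m -> l < m -> k != j -> l != j -> k != l ->
            forall u v, u \in A k -> v \in A l -> e u v]].

Lemma injection_into (T : finType) (B : {set T}) q : q <= #|B| ->
  exists2 g : 'I_q -> T, injective g & forall a, g a \in B.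
Proof.
move=> qB; exists (fun a => enum_val (widen_ord qB a)).
  by move=> a b /enum_val_inj /(congr1 val) /= /val_inj.
by move=> a; exact: enum_valP.
Qed.

Section Patterns.
Variables (m q : nat) (J : rel 'I_q).
Hypotheses (m0 : 0 < m) (q0 : 0 < q).
Hypotheses (Jsym : symmetric J) (Jirr : irreflexive J).

(** Parts 0 and m of K_{m+1}^q form a complete bipartite graph that hosts the forest; the m-1 parts
    between them are joined to both. *)
Lemma pattern_of_blowup (T : finType) (e : rel T) (W : {set T}) : acyclic J ->
  symmetric e -> has_blowup e W m.+1 q -> has_pattern e m J.
Proof.
move=> Jac esym [A [_ Aq Ae]].
have mm : m < m.+1 by [].
have [|||u v u0 vm|g [g1 g2 g3]] :=
  @forest_in_biclique _ J Jsym Jirr Jac T e (A 0) (A m) esym.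
- by rewrite card_ord.
- by rewrite card_ord Aq.
- by rewrite card_ord Aq.
- by apply: (Ae 0 m) => //; rewrite eq_sym -lt0n.
exists 0, A, g; split=> //; split.
- by move=> k km _; rewrite Aq // ltnW.
- move=> a k u km k0 uk; have := g2 a; rewrite inE => /orP[gA|gA].
    by apply: (Ae 0 k) => //; [exact: ltnW|rewrite eq_sym].
  by apply: (Ae m k) => //; [exact: ltnW|rewrite gtn_eqF].
- by move=> k l km lm _ _; apply: Ae; exact: ltnW.
Qed.

Section Clean.
Variables (R : realType) (T : finType) (e : rel T) (f : T -> 'I_m) (rho : R).
Hypotheses (esym : symmetric e) (eirr : irreflexive e).
Hypotheses (rho0 : (0 < rho)%R) (rho1 : (4%:R * m%:R * rho <= 1)%R).
Hypothesis few_missing :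
  (16%:R * (m * q)%:R * (\sum_v missing e f v)%:R <= rho ^+ 2 * #|T|%:R ^+ 2)%R.
Hypothesis big_order : (4%:R * q%:R <= rho * #|T|%:R)%R.
Hypothesis big_class :
  forall k, k < m -> (#|T|%:R <= 2%:R * m%:R * #|class f k|%:R :> R)%R.

(** The q vertices [g a] together miss at most n/(4m) vertices of any other class, n being the
    order; a class has at least n/(2m), so rho n common neighbours remain in each, and the blow-up
    is found among them. *)
Lemma clean_pattern (g : 'I_q -> T) j : j < m -> injective g ->
  (forall a b, J a b -> e (g a) (g b)) -> (forall a, g a \in class f j) ->
  (forall a, missing e f (g a) * (4 * (m * q)) <= #|T|) -> has_pattern e m J.
Proof.
move=> jm gI gJ gj gclean.
pose Z := [set g a | a : 'I_q].
have cZ : #|Z| <= q by rewrite (leq_trans (leq_imset_card _ _)) // card_ord.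
pose h := #|T| %/ (4 * (m * q)).
have d0 : 0 < 4 * (m * q) by rewrite !muln_gt0 m0 q0.
(* Position j is filled with the whole class, as [big_blowup] takes m sets; the pattern ignores the
   part found there. *)
pose W k := if k == j then class f j else common_nbrs e (class f k) Z.
have WC k : W k \subset class f k.
  rewrite /W; case: eqP => [->//|_]; by apply/subsetP => u /common_nbrsP[].
have W_big k : k < m -> (rho * #|T|%:R <= #|W k|%:R)%R.
  move=> km; have [M HM] : exists M : R, M = (m%:R)%R by eexists.
  have M0 : (0 < M)%R by rewrite HM ltr0n.
  have M40 : (0 < 4%:R * M)%R by rewrite mulr_gt0.
  have [N HN] : exists N : R, N = (#|T|%:R)%R by eexists.
  have N0 : (0 <= N)%R by rewrite HN.
  rewrite -HN -(ler_pM2l M40).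
  apply: (@le_trans _ _ N); first by rewrite mulrA -{2}[N]mul1r ler_wpM2r // HM.
  have bk := big_class km; rewrite -HM -HN in bk.
  rewrite /W; case: eqP => [kj|/eqP kj].
    rewrite -kj; have : (0 <= M * #|class f k|%:R)%R by rewrite mulr_ge0 // ltW.
    lra.
  have H : #|class f k| <= #|common_nbrs e (class f k) Z| + q * h.
    apply: leq_trans (leq_add (leqnn _) (leq_mul cZ (leqnn h))).
    apply: card_common_nbrs => z /imsetP[a _ ->].
    have : missing e f (g a) <= h by rewrite leq_divRL.
    rewrite -(leq_add2l (deg e (class f k) (g a))); apply: leq_trans.
    rewrite -(cardsID [set u | e (g a) u] (class f k)) leq_add //; apply: subset_leq_card.
      by apply/subsetP => u; rewrite !inE.
    apply/subsetP => u; rewrite !inE => /andP[-> /eqP uk]; rewrite andbT -val_eqE /= uk.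
    by have := gj a; rewrite inE => /eqP->.
  have qh : 4 * m * (q * h) <= #|T|.
    by rewrite mulnA -(mulnA 4) mulnC leq_divM.
  have {}qh : (4%:R * M * (q * h)%:R <= N)%R by rewrite HM HN -!natrM ler_nat.
  move: H; rewrite -(ler_nat R) natrD => H.
  have : (4%:R * M * #|class f k|%:R <=
      4%:R * M * (#|common_nbrs e (class f k) Z|%:R + (q * h)%:R))%R.
    by rewrite ler_pM2l.
  lra.
have [A [AW Aq Ae]] := @big_blowup R T e m esym m0 f q rho W q0 rho0
  few_missing big_order (fun k _ => WC k) W_big.
exists j, A, g; split=> //; split.
- by move=> k km _; rewrite Aq.
- move=> a k u km kj uA; have := subsetP (AW k km) u uA.
  by rewrite /W (negbTE kj) => /common_nbrsP[_]; apply; exact: imset_f.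
- by move=> k l km lm _ _; exact: Ae.
Qed.

End Clean.
End Patterns.

Section LinearStability.
Variables (R : realType) (m q : nat) (J : rel 'I_q).
Hypotheses (m1 : 1 < m) (q0 : 0 < q).
Hypotheses (Jsym : symmetric J) (Jirr : irreflexive J) (Jac : acyclic J).

(* [dirty] are the vertices with many missing edges, [rich] those with many
   neighbours in their own class: edges at dirty vertices that are not rich are
   paid for by the missing edges. *)
Lemma internal_split (T : finType) (e : rel T) (f : T -> 'I_m) (dirty rich : {set T}) :
  symmetric e ->
  dirty = [set v | #|T| < missing e f v * (4 * (m * q))] ->
  rich = [set v | #|T| < deg e (class f (f v)) v * (16 * (m * q))] ->
  (internal e [set: T] f).*2 <= (\sum_v missing e f v) + 4 * (#|rich| * #|T|) +
    (internal e ([set: T] :\: (rich :|: dirty)) f).*2.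
Proof.
move=> esym dirtyE richE; set X := rich :|: dirty; set M := \sum_v _.
pose d v := deg e (class f (f v)) v.
have dE v : deg (same_class e f) [set: T] v = d v.
  by rewrite deg_same_class; apply: eq_card => u; rewrite !inE.
have := vol_le_rem (same_class_sym f esym) (subsetT X).
rewrite -!internalE; under eq_bigr do rewrite dE.
have : \sum_(v in X) d v <= #|rich| * #|T| + \sum_(v in dirty :\: rich) d v.
  rewrite (big_setID rich) /=; apply: leq_add.
    apply: (@leq_trans (\sum_(v in X :&: rich) #|T|)).
      by apply: leq_sum => v _; apply: leq_trans (deg_le_card _ _ _) _; exact: max_card.
    by rewrite sum_nat_const leq_mul2r subset_leq_card ?orbT // subsetIr.
  rewrite leq_eqVlt; apply/orP; left; apply/eqP; apply: eq_bigl => v.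
  by rewrite !inE; case: (v \in rich); rewrite ?andbF ?andbT.
(* The thresholds 4mq and 16mq differ by the factor 4: a dirty vertex that is not rich has inner
   degree at most a quarter of its missing pairs. The factor is used up by counting an edge from
   both ends and by doubling [internal]. *)
have : 4 * \sum_(v in dirty :\: rich) d v <= M.
  have : (\sum_(v in dirty :\: rich) d v) * (16 * (m * q)) <=
      \sum_(v in dirty :\: rich) missing e f v * (4 * (m * q)).
    rewrite big_distrl /=; apply: leq_sum => v; rewrite richE dirtyE !inE -!leqNgt.
    by case/andP => H1 /ltnW H2; exact: leq_trans H1 H2.
  rewrite -big_distrl /=; have : \sum_(v in dirty :\: rich) missing e f v <= M.
    by rewrite /M [leqRHS](bigID (mem (dirty :\: rich))) leq_addr.
  have : 0 < m * q by rewrite muln_gt0 q0 ltnW.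
  move: (m * q) (\sum_(v in _) d v) (\sum_(v in _) missing _ _ _) M; clear; nia.
move: (\sum_(v in X) d v) (\sum_(v in _) d v) (internal e _ f) (internal e _ f) M.
by move: (#|rich| * #|T|); clear; lia.
Qed.

(** In edge counts the conclusions are 2 B <= M + O(n) and, when [J] has no edge other than xy, 2 B
    <= M, both for the same maximum cut f. In the second case rich vertices and inner edges between
    clean vertices are excluded altogether. *)
Lemma linear_stability :
  exists2 eps : R, (0 < eps)%R & exists C n0 : nat,
  forall (T : finType) (e : rel T), symmetric e -> irreflexive e -> n0 <= #|T| ->
    ((1 - m%:R^-1 - eps) * #|T|%:R ^+ 2 <= (vol e [set: T])%:R :> R)%R ->
    ~ has_pattern e m J ->
    exists f : T -> 'I_m,
      (internal e [set: T] f).*2 <= \sum_v missing e f v + C * #|T| /\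
      ((exists x y, forall a b, J a b -> (a == x) && (b == y) || (a == y) && (b == x)) ->
       (internal e [set: T] f).*2 <= \sum_v missing e f v).
Proof.
have m0 : 0 < m by apply: ltnW.
have [K HK] : exists K : R, K = ((m * q)%:R)%R by eexists.
have mR1 : (1 <= m%:R :> R)%R by rewrite ler1n.
have K1 : (m%:R <= K)%R by rewrite HK ler_nat leq_pmulr.
have K0 : (0 < K)%R by lra.
have g0 : (0 < (16%:R * K)^-1)%R by rewrite invr_gt0 mulr_gt0.
have [c c0 [L HL]] := rich_common m q g0.
(* A lower bound, relative to the order, for all sets handed to [big_blowup]: common neighbourhoods
   of rich vertices (c), neighbourhoods of one rich vertex (1/(16mq)), and common neighbourhoods of
   clean vertices (1/(4m)). *)
pose rho : R := Num.min c ((16%:R * K)^-1)%R.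
have rho0 : (0 < rho)%R by rewrite lt_min c0 g0.
have rhoc : (rho <= c)%R by rewrite ge_min lexx.
have rhog : (rho <= (16%:R * K)^-1)%R by rewrite ge_min lexx orbT.
have rhoK : (16%:R * K * rho <= 1)%R.
  have k0 : (0 < 16%:R * K)%R by rewrite mulr_gt0.
  by rewrite -[leRHS](mulfV (lt0r_neq0 k0)) ler_pM2l.
have rho_m : (16%:R * m%:R * rho <= 1)%R.
  by apply: le_trans rhoK; rewrite ler_wpM2r ?(ltW rho0) // ler_pM2l.
have rho1 : (16%:R * rho <= 1)%R.
  by apply: le_trans rho_m; rewrite ler_wpM2r ?(ltW rho0) // ler_peMr.
pose d : R := Num.min ((8%:R * m%:R ^+ 2)^-1)%R (rho ^+ 2 / (32%:R * K))%R.
have m20 : (0 < m%:R ^+ 2 :> R)%R by rewrite exprn_gt0 // ltr0n.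
have d0 : (0 < d)%R.
  by rewrite lt_min invr_gt0 mulr_gt0 // divr_gt0 ?exprn_gt0 // mulr_gt0.
have dm : (8%:R * m%:R ^+ 2 * d <= 1)%R.
  have k0 : (0 < 8%:R * m%:R ^+ 2 :> R)%R by rewrite mulr_gt0.
  by rewrite -[leRHS](mulfV (lt0r_neq0 k0)) ler_pM2l // ge_min lexx.
have dK : (32%:R * K * d <= rho ^+ 2)%R.
  by rewrite [leLHS]mulrC -ler_pdivlMr ?mulr_gt0 // ge_min lexx orbT.
have [eps eps0 [n1 stab]] := stability q m1 d0.
have [n2 Hn2] := exists_nat_ge (4%:R * q%:R / rho)%R.
exists (Num.min eps d); first by rewrite lt_min eps0 d0.
(* 4L pays for fewer than L rich vertices in [internal_split], 4q for the clean classes, each of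
   volume at most 2q times its size, after doubling. *)
exists (4 * L + 4 * q), (n1 + n2).+1 => T e esym eirr nT vT nopat.
have noK : ~ has_blowup e [set: T] m.+1 q.
  by move=> H; apply: nopat; exact: pattern_of_blowup H.
have [N HN] : exists N : R, N = (#|T|%:R)%R by eexists.
have N0 : (0 < N)%R by rewrite HN ltr0n; apply: leq_trans nT.
have N20 : (0 <= N ^+ 2)%R by rewrite sqr_ge0.
rewrite -HN in vT.
have [||f0 Hf0] := stab T e esym eirr _ _ noK.
- by move: nT; clear; lia.
- by rewrite -HN; apply: le_trans vT; rewrite ler_wpM2r // lerD2l lerN2 ge_min lexx.
have [f [Hf cut]] := max_cut esym eirr f0.
have [|||few_missing big_class] := @class_bounds R T e m m0 f d.
- rewrite -HN; apply: le_trans vT; rewrite ler_wpM2r // lerD2l lerN2 ge_min lexx orbT //.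
- by apply: le_trans Hf0; rewrite ler_nat.
- exact: dm.
rewrite -HN in few_missing Hf0.
have {}few_missing :
    (16%:R * (m * q)%:R * (\sum_v missing e f v)%:R <= rho ^+ 2 * #|T|%:R ^+ 2)%R.
  rewrite -HK -HN; apply: (@le_trans _ _ (16%:R * K * (2%:R * d * N ^+ 2))%R).
    by rewrite ler_pM2l // mulr_gt0.
  by rewrite (_ : _ * _ = 32%:R * K * d * N ^+ 2)%R ?ler_wpM2r //; ring.
have big_order : (4%:R * q%:R <= rho * #|T|%:R)%R.
  rewrite [leRHS]mulrC -ler_pdivrMr //; apply: le_trans Hn2 _.
  by rewrite ler_nat; move: nT; clear; lia.
have rho4 : (4%:R * m%:R * rho <= 1)%R.
  have : (0 <= m%:R * rho)%R by rewrite mulr_ge0 // ltW.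
  lra.
pose clean := clean_pattern m0 q0 (J := J) esym rho0 rho4 few_missing big_order big_class.
pose dirty := [set v | #|T| < missing e f v * (4 * (m * q))].
pose rich := [set v | #|T| < deg e (class f (f v)) v * (16 * (m * q))].
have split := internal_split esym (erefl dirty) (erefl rich).
exists f.
have rich_deg v k : v \in rich -> k < m -> ((16%:R * K)^-1 * N <= (deg e (class f k) v)%:R)%R.
  rewrite inE => vr km; rewrite [leLHS]mulrC ler_pdivrMr ?mulr_gt0 //.
  rewrite HK HN -!natrM ler_nat; apply: leq_trans (ltnW vr) _.
  by rewrite leq_mul2r; apply/orP; right; exact: (cut v (Ordinal km)).
have blow := @big_blowup R T e m esym m0 f q rho _ q0 rho0 few_missing big_order.
have not_dirty v : v \notin dirty -> missing e f v * (4 * (m * q)) <= #|T|.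
  by rewrite inE -leqNgt.
split.
- have cR : #|rich| < L.
    rewrite ltnNge; apply/negP => LR.
    have [v k vr km|Y [YR qY HY]] := HL T e (class f) rich esym LR.
      by rewrite -HN; exact: rich_deg.
    have [k km|k km|A [AW Aq Ae]] := blow (fun k => common_nbrs e (class f k) Y).
    + by apply/subsetP => u /common_nbrsP[].
    + by apply: le_trans (HY k km); rewrite ler_wpM2r.
    have AY k u y : k < m -> u \in A k -> y \in Y -> e y u.
      by move=> km /(subsetP (AW k km))/common_nbrsP[_]; apply.
    apply: noK; apply: (@has_blowup_leq _ _ _ _ _ (fun k => if k == m then Y else A k)).
    + by move=> k _; exact: subsetT.
    + move=> k; rewrite ltnS leq_eqVlt; case: eqP => [_ _ //|_ /= km].
      by rewrite Aq.
    + move=> k l; rewrite !ltnS (leq_eqVlt k) (leq_eqVlt l).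
      case: (eqVneq k m) => [->|_ /=]; case: (eqVneq l m) => [->|_ /=] //=.
      * by move=> _ lm _ u v uY vA; apply: (AY l).
      * by move=> km _ _ u v uA vY; rewrite esym; apply: (AY k).
      * by move=> km lm; exact: Ae.
  have small (i : 'I_m) :
      vol e [set u in [set: T] :\: (rich :|: dirty) | f u == i] <= (q * #|class f i|).*2.
    set U := [set u in _ | _].
    apply: (@leq_trans (q * #|U|).*2); last first.
      rewrite leq_double leq_mul2l subset_leq_card ?orbT //; apply/subsetP => u.
      by rewrite !inE => /andP[_ /eqP->].
    rewrite leqNgt; apply/negP => dense.
    have := @forest_in_dense _ J Jsym Jirr Jac R T e U esym eirr.
    rewrite card_ord => /(_ dense)[g [g1 g2 g3]].
    apply: nopat; apply: (clean g i) => // a; have := g2 a.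
      by rewrite !inE => /andP[_ /eqP->].
    by rewrite inE => /andP[/setDP[_]]; rewrite in_setU negb_or => /andP[_] + _; exact: not_dirty.
  apply: leq_trans split _; rewrite internal_vol.
  have : \sum_(i < m) vol e [set u in [set: T] :\: (rich :|: dirty) | f u == i]
      <= (q * #|T|).*2.
    apply: leq_trans (leq_sum _ (fun i _ => small i)) _.
    rewrite -(sum_card_class f) -!muln2 big_distrr big_distrl /=.
    by apply: leq_sum => i _; rewrite muln2.
  have : #|rich| * #|T| <= L * #|T| by rewrite leq_mul2r (ltnW cR) orbT.
  move: (\sum_(i < m) _) (\sum_v _) (#|rich| * #|T|); clear; nia.
- case=> x [y Jxy].
  have rich0 : rich = set0.
    apply/eqP; rewrite -subset0; apply/subsetP => v vr.
    have [k km|k km|A [AW Aq Ae]] := blow (fun k => [set u in class f k | e v u]).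
    + by apply/subsetP => u; rewrite inE => /andP[].
    + rewrite -HN; apply: le_trans (rich_deg v k vr km).
      by rewrite ler_wpM2r // ltW.
    have Av k u : k < m -> u \in A k -> e v u.
      by move=> km /(subsetP (AW k km)); rewrite inE => /andP[].
    have [|g g1 g2] := @injection_into T (A 0) q; first by rewrite Aq.
    have vg a : v != g a.
      by apply: contraFneq (eirr v) => {2}->; apply: (Av 0).
    (* The blow-up lies in the neighbourhood of v, so v can take the place of x while y stays in
       [A 0]; all other vertices of [J] are isolated. *)
    exfalso; apply: nopat; exists 0, A, (fun a => if a == x then v else g a).
    split=> //.
    + move=> a b; case: (eqVneq a x) => [->|ax]; case: (eqVneq b x) => [->|bx] //.
      * by move/eqP; rewrite (negbTE (vg b)).
      * by move/eqP; rewrite eq_sym (negbTE (vg a)).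
      * exact: g1.
    + move=> a b Jab; have /orP[] := Jxy a b Jab => /andP[/eqP aE /eqP bE]; subst a b.
        rewrite eqxx; case: eqP => [yx|_]; first by rewrite yx Jirr in Jab.
        exact: (Av 0).
      rewrite eqxx; case: eqP => [yx|_]; first by rewrite yx Jirr in Jab.
      by rewrite esym; exact: (Av 0).
    + split.
      * by move=> k km _; rewrite Aq.
      * move=> a k u km k0 uA; case: eqP => _; first exact: (Av k).
        by apply: (Ae 0 k) => //; rewrite eq_sym.
      * by move=> k l km lm _ _; exact: Ae.
  apply: leq_trans split _; rewrite rich0 set0U cards0 mul0n muln0 addn0.
  rewrite -[leqRHS]addn0 leq_add2l leqn0 double_eq0 internalE /vol sum_nat_eq0.
  apply/forallP => v; apply/implyP; rewrite in_setD => /andP[vd _].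
  rewrite cards_eq0 -subset0; apply/subsetP => u; rewrite in_set in_setD => /andP[/andP[ud _]].
  case/andP => evu /eqP fuv; exfalso; apply: nopat.
  have uv : u != v by apply: contraFneq (eirr v) => {2}<-.
  (* The edge uv takes the places of x and y. The isolated vertices of [J] still need images that
     are clean, in the same class and different from u and v; [B] supplies them. *)
  pose B := ((class f (f v) :\: dirty) :\ u) :\ v.
  have qB : q <= #|B|.
    have cd : (#|dirty|%:R * 4%:R <= rho * N)%R.
      have : (#|dirty|%:R * N <= 4%:R * K * (\sum_v missing e f v)%:R)%R.
        have := @card_exceeding R T (fun v => missing e f v * (4 * (m * q))) N.
        rewrite -big_distrl /= (natrM _ (\sum_v _)) (natrM _ 4) -HK.
        rewrite (_ : [set v | _] = dirty); first lra.
        by apply/setP => w; rewrite !inE HN ltr_nat.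
      have := few_missing; rewrite -HK -HN => H1 H2.
      have H3 : (rho ^+ 2 * N ^+ 2 <= rho * N ^+ 2)%R.
        rewrite ler_wpM2r // expr2 ger_pMl //; lra.
      by rewrite -(ler_pM2r N0); move: H3; rewrite expr2; lra.
    have := big_class _ (ltn_ord (f v)); rewrite -HN => cc.
    have cc' : (8%:R * rho * N <= #|class f (f v)|%:R)%R.
      have H : (16%:R * m%:R * rho * N <= 1 * N)%R by rewrite ler_wpM2r // ltW.
      have mR0 : (0 < m%:R :> R)%R by lra.
      rewrite -(ler_pM2l mR0); lra.
    have c1 : #|class f (f v)| <= #|B| + #|dirty| + 2.
      have := cardsD1 u (class f (f v) :\: dirty).
      have := cardsD1 v ((class f (f v) :\: dirty) :\ u); rewrite -/B.
      have := cardsID dirty (class f (f v)).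
      have := subset_leq_card (subsetIr (class f (f v)) dirty).
      case: (_ \in _); case: (_ \in _); clear; lia.
    move: c1; rewrite -(ler_nat R) !natrD => c1.
    rewrite -(ler_nat R); have := big_order; rewrite -HN.
    have : (1 <= q%:R :> R)%R by rewrite ler1n.
    lra.
  have [g g1 g2] := injection_into qB.
  have gB a : [/\ g a != v, g a != u, g a \notin dirty & g a \in class f (f v)].
    by have := g2 a; rewrite !in_setD1 in_setD => /and4P[].
  apply: (clean (fun a => if a == x then v else if a == y then u else g a) (f v)) => //.
  + move=> a b; case: (eqVneq a x) => [->|ax]; case: (eqVneq b x) => [->|bx] //.
    * case: (eqVneq b y) => _ /eqP; first by rewrite eq_sym (negbTE uv).
      by rewrite eq_sym; case: (gB b) => /negbTE->.
    * case: (eqVneq a y) => _ /eqP; first by rewrite (negbTE uv).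
      by case: (gB a) => /negbTE->.
    * case: (eqVneq a y) => [->|ay]; case: (eqVneq b y) => [->|by_] //.
      - by move/eqP; rewrite eq_sym; case: (gB b) => _ /negbTE->.
      - by move/eqP; case: (gB a) => _ /negbTE->.
      - exact: g1.
  + move=> a b Jab; have /orP[] := Jxy a b Jab => /andP[/eqP aE /eqP bE]; subst a b.
      rewrite !eqxx; case: eqP => [yx|_ //]; by rewrite yx Jirr in Jab.
    rewrite !eqxx; case: eqP => [yx|_]; first by rewrite yx Jirr in Jab.
    by rewrite esym.
  + move=> a; case: eqP => _; first by rewrite inE.
    case: eqP => _; last by case: (gB a).
    by rewrite inE fuv.
  + move=> a; apply: not_dirty; case: eqP => _ //; case: eqP => _ //.
    by case: (gB a).
Qed.

End LinearStability.

(** * Subgraphs, edges and edit distance *)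

Definition embeds (H G : sgraph) : Prop :=
  exists2 f : H -> G, injective f & forall u v, adj u v -> adj (f u) (f v).

Lemma embeds_trans (H G K : sgraph) : embeds H G -> embeds G K -> embeds H K.
Proof.
move=> [f fI fe] [g gI ge]; exists (g \o f); first exact: inj_comp.
by move=> u v /fe /ge.
Qed.

(** The graph that G induces on the image of an embedded [H] is [H] with edges added, a member of
    [up F]. So induced freeness from the closure is ordinary subgraph freeness from [F]. *)
Lemma Forb_upP (F : graph_family) G :
  Forb (up F) G <-> forall H, F H -> ~ embeds H G.
Proof.
split=> [FG H FH [f fI fe]|noH [K [H FH [f [g fK gK] fe]] [h hI he]]].
  apply: FG.
  have rsym : symmetric (fun u v : H => adj (f u) (f v)) by move=> u v; exact: adj_sym.
  have rirr : irreflexive (fun u v : H => adj (f u) (f v)) by move=> u; exact: adj_irr.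
  exists (SGraph rsym rirr); last by exists f.
  by exists H => //; exists id => //; exists id.
apply: (noH H FH); exists (h \o f); first by apply: inj_comp => //; exact: can_inj fK.
by move=> u v /fe; rewrite /= he.
Qed.

Lemma not_ForbP (F : graph_family) G :
  ~ Forb (up F) G <-> exists2 H, F H & embeds H G.
Proof.
split=> [nF|[H FH HG] /Forb_upP/(_ H FH)//].
apply: boolp.contrapT => nH; apply: nF; apply/Forb_upP => H FH HG.
by apply: nH; exists H.
Qed.

Lemma edgesP (G : sgraph) (u v : G) : ([set u; v] \in edges G) = adj u v.
Proof.
apply/imsetP/idP => [[[a b] /=]|uv]; last by exists (u, v).
rewrite inE /= => ab E.
have : u \in [set a; b] by rewrite -E !inE eqxx.
have : v \in [set a; b] by rewrite -E !inE eqxx orbT.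
have : a \in [set u; v] by rewrite E !inE eqxx.
have : b \in [set u; v] by rewrite E !inE eqxx orbT.
rewrite !inE => /orP[]/eqP bE /orP[]/eqP aE; subst a b.
- by rewrite adj_irr in ab.
- by rewrite adj_sym ab.
- by [].
- by rewrite adj_irr in ab.
Qed.

Lemma adj_add_edges (G : sgraph) (S : {set {set G}}) (u v : G) :
  adj (u : add_edges S) v = (u != v) && (adj u v || ([set u; v] \in S)).
Proof. by rewrite /= inE edgesP. Qed.

Lemma colorable_embeds (H G : sgraph) k : embeds H G -> colorable G k -> colorable H k.
Proof.
move=> [f _ fe] /existsP[c /forallP cP]; apply/existsP; exists [ffun u => c (f u)].
apply/forallP => u; apply/forallP => v; apply/implyP => /fe uv; rewrite !ffunE.
by move/forallP: (cP (f u)) => /(_ (f v)); rewrite uv.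
Qed.

Lemma blowup_colorable m (T : finType) (f : T -> complete_graph m) :
  colorable (blowup f) m.
Proof.
apply/existsP; exists [ffun u => f u : 'I_m]; apply/forallP => u; apply/forallP => v.
by rewrite !ffunE; apply/implyP.
Qed.

Lemma colorable_Forb (F : graph_family) m G :
  min_chi F m.+1 -> colorable G m -> Forb (up F) G.
Proof.
move=> [_ Fchi] Gm; apply/Forb_upP => H FH /colorable_embeds/(_ Gm) Hm.
have := Fchi H FH; rewrite /chi; case: ex_minnP => k _ /(_ m Hm) km.
by rewrite ltnNge km.
Qed.

Section Counting.
Variables (T : finType) (r : rel T).
Hypotheses (rsym : symmetric r) (rirr : irreflexive r).

Lemma double_card_pairs :
  #|[set [set p.1; p.2] | p in [pred p : T * T | r p.1 p.2]]|.*2 = vol r [set: T].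
Proof.
set P := [pred p : T * T | r p.1 p.2].
have -> : vol r [set: T] = \sum_(p in P) 1.
  rewrite (_ : \sum_(p in P) 1 = \sum_(p : T * T) r p.1 p.2); last first.
    by rewrite big_mkcond; apply: eq_bigr => p _; rewrite inE; case: (r _ _).
  rewrite -(pair_bigA_idem _ (fun u v => r u v : nat)) //=.
  by apply: eq_big => [v|v _]; [rewrite inE|rewrite degE; apply: eq_bigl => u; rewrite inE].
rewrite (partition_big_imset (fun p : T * T => [set p.1; p.2])) /=.
rewrite -muln2 -sum_nat_const; apply: eq_bigr => A /imsetP[[a b] /=].
rewrite inE /= => ab ->.
have ab' : a != b by apply: contraTneq ab => ->; rewrite ?inE /= rirr.
rewrite sum1_card (@eq_card _ _ [set (a, b); (b, a)]).
  by rewrite cards2 xpair_eqE (negbTE ab').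
move=> [u v]; rewrite !inE /= !xpair_eqE; apply/andP/orP.
  rewrite [_ \in P]inE /= => -[uv /eqP E].
  have : u \in [set a; b] by rewrite -E !inE eqxx.
  have : v \in [set a; b] by rewrite -E !inE eqxx orbT.
  rewrite !inE => /orP[]/eqP vE /orP[]/eqP uE; subst u v.
  - by rewrite rirr in uv.
  - by right; rewrite !eqxx.
  - by left; rewrite !eqxx.
  - by rewrite rirr in uv.
rewrite [_ \in P]inE /=; case=> /andP[/eqP-> /eqP->]; first by rewrite eqxx ab.
by rewrite rsym ab setUC eqxx.
Qed.

End Counting.

Lemma double_card_edges (G : sgraph) : #|edges G|.*2 = vol (@adj G) [set: G].
Proof. by apply: double_card_pairs; [exact: adj_sym | exact: adj_irr]. Qed.

Lemma card_edges_le (G : sgraph) : #|edges G| <= 'C(#|G|, 2).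
Proof.
rewrite bin2 -(doubleK #|edges G|) half_leq // double_card_edges /vol.
apply: (@leq_trans (\sum_(v in [set: G]) #|G|.-1)); last by rewrite sum_nat_const cardsT.
apply: leq_sum => v _; rewrite -(cardC1 v); apply: subset_leq_card.
apply/subsetP => u; rewrite !inE => /andP[_]; apply: contraTneq => ->.
by rewrite adj_irr.
Qed.

Section Blowups.
Variables (T : finType) (m : nat) (f : T -> 'I_m).

Lemma vol_blowup :
  vol (@adj (blowup (f : T -> complete_graph m))) [set: T] +
    \sum_(i < m) #|class f i| ^ 2 = #|T| ^ 2.
Proof.
have := @cut_balance T (@adj (blowup (f : T -> complete_graph m))) m f.
rewrite [\sum_v missing _ _ _]big1 ?addn0; last first.
  move=> v _; apply/eqP; rewrite cards_eq0 -subset0; apply/subsetP => u.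
  by rewrite inE /= [f v == _]eq_sym andbN.
move=> ->; rewrite internal_setT big1 ?addn0 // => v _.
apply/eqP; rewrite cards_eq0 -subset0; apply/subsetP => u.
by rewrite !inE val_eqE /= => /andP[/eqP ->]; rewrite eqxx.
Qed.

Lemma vol_blowup_balance (e : rel T) :
  vol (@adj (blowup (f : T -> complete_graph m))) [set: T] + internal e [set: T] f =
  vol e [set: T] + \sum_v missing e f v.
Proof.
have := @cut_balance T e m f; have := vol_blowup.
by move: (\sum_(i < m) _) (vol _ _) (vol _ _) (internal _ _ _) (\sum_v _) (#|T| ^ 2); clear; lia.
Qed.

Lemma double_edit_dist (e : rel T) : symmetric e -> irreflexive e ->
  (edit_dist e (@adj (blowup (f : T -> complete_graph m)))).*2 =
  internal e [set: T] f + \sum_v missing e f v.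
Proof.
move=> esym eirr; pose r u v := e u v != (f u != f v).
rewrite (@double_card_pairs T r) //; first last.
- by move=> u; rewrite /r eirr eqxx.
- by move=> u v; rewrite /r esym [f u == _]eq_sym.
rewrite internal_setT -big_split /=; apply: eq_big => [v|v _]; first by rewrite inE.
rewrite degE /missing /deg -!sum1_card big_mkcond [X in _ = X + _]big_mkcond.
rewrite [X in _ = _ + X]big_mkcond -big_split /=; apply: eq_bigr => u _.
by rewrite !inE /r val_eqE [f v == _]eq_sym; case: (f u == f v); case: (e v u).
Qed.

End Blowups.

(** The volume of a blow-up is n^2 minus the sum of squared class sizes, and summing 2xq <= x^2 +
    q^2 over the classes shows that equal classes minimise that sum. *)
Lemma vol_blowup_le (m q : nat) (T : finType) (f : T -> 'I_m) : #|T| = m * q ->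
  vol (@adj (blowup (f : T -> complete_graph m))) [set: T] <=
  vol (@adj (complete_blowup m q)) [set: complete_blowup m q].
Proof.
move=> cT; have := vol_blowup f; have := @vol_blowup ('I_m * 'I_q)%type m fst.
rewrite card_prod !card_ord cT => E1 E2.
have cl (i : 'I_m) : #|class (fst : 'I_m * 'I_q -> 'I_m) i| = q.
  rewrite (@eq_card _ _ [set (i, a) | a : 'I_q]); first last.
    move=> [k a]; rewrite !inE /= val_eqE; apply/eqP/imsetP => [->|[b _ [-> _]] //].
    by exists a.
  by rewrite card_imset ?card_ord // => a b [].
rewrite -(leq_add2r (\sum_(i < m) #|class f i| ^ 2)) E2 -E1 leq_add2l.
rewrite (eq_bigr (fun=> q ^ 2)) => [|i _]; last by rewrite cl.
rewrite sum_nat_const card_ord -(leq_add2r (m * q ^ 2)).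
have := sum_card_class f; rewrite cT => S.
apply: (@leq_trans (\sum_(i < m) 2 * (#|class f i| * q))).
  by rewrite -big_distrr -big_distrl /= S -mulnA mulnn mul2n addnn.
rewrite (_ : m * q ^ 2 = \sum_(i < m) q ^ 2); last by rewrite sum_nat_const card_ord.
by rewrite -big_split /=; apply: leq_sum => i _; exact: nat_Cauchy.
Qed.

(** Classes are the residues modulo m of an enumeration; inside a residue class the quotient by m
    determines the element, so sizes are at most n/m + 1. The error linear in n is absorbed into eps
    later. *)
Lemma balanced_cut (T : finType) m : 0 < m -> exists f : T -> 'I_m,
  #|T| * #|T| * m.-1 <=
  m * (vol (@adj (blowup (f : T -> complete_graph m))) [set: T] + #|T|).
Proof.
move=> m0; pose f (u : T) := Ordinal (ltn_pmod (enum_rank u : nat) m0).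
exists f.
have cl (i : 'I_m) : #|class f i| <= (#|T| %/ m).+1.
  pose g (u : T) : 'I_(#|T| %/ m).+1 := inord ((enum_rank u : nat) %/ m).
  rewrite -[X in _ <= X]card_ord -(@card_in_imset _ _ g) ?max_card //.
  move=> u v; rewrite !inE /= => /eqP ui /eqP vi /(congr1 val).
  rewrite /= !inordK ?ltnS ?leq_div2r // ?(ltnW (ltn_ord _)) // => E.
  apply: enum_rank_inj; apply: val_inj; rewrite /= [LHS](divn_eq _ m) [RHS](divn_eq _ m).
  by rewrite E ui vi.
have : \sum_(i < m) #|class f i| ^ 2 <= #|T| * (#|T| %/ m).+1.
  rewrite -(sum_card_class f) big_distrl /=; apply: leq_sum => i _.
  by rewrite -mulnn leq_mul2l sum_card_class cl orbT.
have := vol_blowup f; have := leq_divM #|T| m.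
move: (\sum_(i < m) _) (vol _ _) (#|T| %/ m) #|T| => s V d n; rewrite -mulnn.
case: m m0 {f cl} => // k _ /=; clear; nia.
Qed.

(** Part i of K_m^q goes to the copy of the inner graph, and the transposition of i and j carries
    the other parts to the sets [A k] with k different from j. *)
Lemma pattern_embeds (G : sgraph) m q (i : 'I_m) (S : {set {set complete_blowup m q}}) :
  (forall e, e \in S -> e \subset blowup_part q i) ->
  has_pattern (@adj G) m (fun a b : 'I_q => (a != b) && ([set (i, a); (i, b)] \in S)) ->
  embeds (add_edges S) G.
Proof.
move=> Si [j [A [g [jm gI gJ [Aq gA Ae]]]]].
pose j' := Ordinal jm.
have : forall k : 'I_m, exists h : 'I_q -> G,
    k != j' -> injective h /\ forall a, h a \in A k.
  move=> k; case: (eqVneq k j') => [_|kj]; first by exists g.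
  have [h hI hA] := injection_into (Aq k (ltn_ord k) kj).
  by exists h.
case/fin_all_exists => h hP.
pose p := tperm i j'.
have pj k : k != i -> p k != j'.
  by move=> ki; rewrite -(tpermL i j') (inj_eq perm_inj).
pose F (u : complete_blowup m q) : G := if u.1 == i then g u.2 else h (p u.1) u.2.
have hA k a : k != i -> h (p k) a \in A (p k) by move=> /pj/hP[].
have cross u v : u.1 != v.1 -> adj (F u) (F v).
  move=> uv; rewrite /F; case: (eqVneq u.1 i) => [ui|ui]; case: (eqVneq v.1 i) => [vi|vi].
  - by rewrite ui vi eqxx in uv.
  - by apply: (gA _ (p v.1)) => //; [exact: pj | exact: hA].
  - by rewrite adj_sym; apply: (gA _ (p u.1)) => //; [exact: pj | exact: hA].
  - apply: (Ae (p u.1) (p v.1)) => //; try exact: pj; try exact: hA.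
    by rewrite val_eqE (inj_eq perm_inj).
exists F.
  move=> u v Fuv; case: (eqVneq u.1 v.1) => [uv|/cross]; last by rewrite Fuv adj_irr.
  have uv2 : u.2 = v.2.
    move: Fuv; rewrite /F uv; case: (eqVneq v.1 i) => [_|vi]; first exact: gI.
    by have [hI _] := hP _ (pj _ vi); apply: hI.
  by case: u v uv uv2 {Fuv} => [a b] [c d] /= -> ->.
move=> u v; rewrite adj_add_edges => /andP[uv /orP[|uvS]]; first exact: cross.
have /subsetP uvi := Si _ uvS.
have ui : u.1 = i by have := uvi u; rewrite !inE eqxx => /(_ isT)/eqP.
have vi : v.1 = i by have := uvi v; rewrite !inE eqxx orbT => /(_ isT)/eqP.
rewrite /F ui vi eqxx; apply: gJ.
have uE : u = (i, u.2) by rewrite -ui; case: (u).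
have vE : v = (i, v.2) by rewrite -vi; case: (v).
rewrite -uE -vE uvS andbT; apply: contraNneq uv => E.
by rewrite uE vE E.
Qed.

(** * Sparse graphs without short cycles *)

Section Balls.
Variables (T : finType) (e : rel T).

Fixpoint ball (u : T) (n : nat) : {set T} :=
  if n is n'.+1 then ball u n' :|: \bigcup_(w in ball u n') [set x | e w x]
  else [set u].

Lemma ball_mono u i j : i <= j -> ball u i \subset ball u j.
Proof.
by move/subnKC <-; elim: (j - i) => [|n IH]; rewrite ?addn0 // addnS /= subsetU ?IH.
Qed.

Lemma path_in_ball u p : path e u p -> last u p \in ball u (size p).
Proof.
elim/last_ind: p => [|p x IH]; first by rewrite inE.
rewrite rcons_path last_rcons size_rcons /= => /andP[/IH pu ex].
by rewrite inE; apply/orP; right; apply/bigcupP; exists (last u p); rewrite ?inE.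
Qed.

Lemma card_ball u d n : (forall v, deg e [set: T] v <= d) -> #|ball u n| <= d.+1 ^ n.
Proof.
move=> ed; elim: n => [|n IH] /=; first by rewrite cards1.
rewrite expnS mulSn cardsU (leq_trans (leq_subr _ _)) // leq_add //.
apply: leq_trans (leq_mul (leqnn d) IH); rewrite mulnC -sum_nat_const.
apply: leq_trans (card_bigcup_le _ _) _; apply: leq_sum => w _.
apply: leq_trans (ed w); apply: subset_leq_card; apply/subsetP => x.
by rewrite !inE.
Qed.

(** A cycle of e' that is not one of e runs through the new pair uv; the rest of it is a path of e
    between u and v with one edge fewer. *)
Lemma new_cycle_path (e' : rel T) u v c : symmetric e ->
  (forall a b, e' a b -> e a b \/ [set a; b] = [set u; v]) ->
  2 < size c -> ucycle e' c -> ~ ucycle e c -> v \in ball u (size c).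
Proof.
move=> esym e'e c2 /andP[cyc uc] nc.
have [x xc nex] : exists2 x, x \in c & ~~ e x (next c x).
  apply/hasP; apply/negPn/negP => /hasPn H; apply: nc; apply/andP; split=> //.
  by apply: cycle_from_next => // x /H; rewrite negbK.
have e'x : e' x (next c x) by apply: next_cycle.
have [i s rc] := rot_to xc.
have nx : next (x :: s) x = next c x by rewrite -rc next_rot.
have sz : size c = (size s).+1 by rewrite -(size_rot i c) rc.
move: cyc uc; rewrite -(rot_cycle i) -(rot_uniq i) rc.
case: s rc nx sz => [|y s] rc /=; first by move=> _ sz; rewrite sz in c2.
rewrite eqxx => yE sz; rewrite -yE in nex e'x => /andP[_].
rewrite rcons_path => /andP[pys elx] /andP[xys /andP[ys us]].
have xy : [set x; y] = [set u; v] by case: (e'e _ _ e'x) => // exy; rewrite exy in nex.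
have s0 : s != [::] by apply: contraTneq c2 => s0; rewrite sz s0.
have pe : path e y (rcons s x).
  rewrite rcons_path; apply/andP; split.
    apply: (@sub_in_path _ (predC1 x) e' e) pys.
      move=> a b; rewrite !inE => ax bx /e'e[//|ab].
      have : x \in [set a; b] by rewrite ab -xy !inE eqxx.
      by rewrite !inE ![x == _]eq_sym (negbTE ax) (negbTE bx).
    by apply/allP => a ays; apply: contraNneq xys => <-.
  case: (e'e _ _ elx) => // E.
  have ls : last y s \in s by case: (s) s0 => //= a t _; exact: mem_last.
  have : y \in [set last y s; x] by rewrite E -xy !inE eqxx orbT.
  rewrite !inE => /orP[]/eqP yl; first by rewrite yl ls in ys.
  by rewrite -yl inE eqxx in xys.
(* The cycle may traverse the pair in either direction, so it is open which of x and y is u; the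
   reversed path covers the other case. *)
have pe' : path e x (rcons (rev s) y).
  have := rev_path e y (rcons s x); rewrite last_rcons belast_rcons rev_cons => ->.
  by rewrite (eq_path (e' := e)) // => a b; exact: esym.
have Hx : x \in ball y (size c).
  have := path_in_ball pe; rewrite last_rcons size_rcons sz; apply/subsetP.
  by apply: ball_mono.
have Hy : y \in ball x (size c).
  have := path_in_ball pe'; rewrite last_rcons size_rcons size_rev sz; apply/subsetP.
  by apply: ball_mono.
have ux : u \in [set x; y] by rewrite xy !inE eqxx.
have vx : v \in [set x; y] by rewrite xy !inE eqxx orbT.
have x0 : x \in [set u; v] by rewrite -xy !inE eqxx.
have y0 : y \in [set u; v] by rewrite -xy !inE eqxx orbT.
have xny : x != y by apply: contraNneq xys => ->; rewrite inE eqxx.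
move: ux vx x0 y0; rewrite !inE => /orP[]/eqP-> /orP[]/eqP-> //.
  by rewrite orbb orbb => _ yx; rewrite eq_sym yx in xny.
by rewrite orbb => xy'; rewrite xy' in xny.
Qed.

End Balls.

(* Erdős–Sachs: in an edge-maximal graph of maximum degree at most [d] without
   cycles of length at most [k], the vertices of degree less than [d] are at
   distance at most [k] from each other. *)
Lemma erdos_sachs (T : finType) (W : {set T}) d k :
  exists S : {set {set T}},
    [/\ forall p, p \in S -> p \subset W,
        forall c : seq T, 2 < size c <= k -> ~ ucycle (@adj (graph_of S)) c &
        d * (#|W| - d.+1 ^ k.+1) <= vol (@adj (graph_of S)) [set: T]].
Proof.
pose P (S : {set {set T}}) := [/\ forall p, p \in S -> p \subset W,
  forall c : seq T, 2 < size c <= k -> ~ ucycle (@adj (graph_of S)) c &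
  forall v, deg (@adj (graph_of S)) [set: T] v <= d].
have P0 : boolp.asbool (P set0).
  apply/boolp.asboolP; split=> [p|c|v]; first by rewrite inE.
    by case: c => [|a [|b c]] // _ /andP[/= /andP[+ _] _]; rewrite inE andbF.
  rewrite (_ : deg _ _ _ = 0) //; apply/eqP; rewrite cards_eq0 -subset0.
  by apply/subsetP => u; rewrite !inE /= inE andbF.
have [S /boolp.asboolP[SW Scyc Sdeg] Smax] :=
  @arg_maxnP _ set0 (fun S => boolp.asbool (P S)) (fun S : {set {set T}} => #|S|) P0.
exists S; split=> //.
set e := @adj (graph_of S) in Scyc Sdeg *.
have esym : symmetric e by exact: adj_sym.
pose L := [set v in W | deg e [set: T] v < d].
(* Radius k+1 instead of k, so that the ball contains the neighbours of u even for k = 0. *)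
have cL : #|L| <= d.+1 ^ k.+1.
  case: (set_0Vmem L) => [->|[u uL]]; first by rewrite cards0.
  apply: leq_trans (card_ball u k.+1 Sdeg); apply: subset_leq_card.
  apply/subsetP => v vL; apply: contraT => vb.
  have uv : u != v.
    apply: contraNneq vb => <-; apply: (subsetP (ball_mono e u (leq0n k.+1))).
    by rewrite inE.
  have uvS : [set u; v] \notin S.
    apply: contraNN vb => uvS; have euv : e u v by rewrite /e /= uv uvS.
    apply: (subsetP (ball_mono e u (ltn0Sn k))).
    have := @path_in_ball _ e u [:: v]; rewrite /= euv; exact.
  pose S' := [set u; v] |: S; pose e' := @adj (graph_of S').
  have e'e a b : e' a b -> e a b \/ [set a; b] = [set u; v].
    rewrite /e' /e /= in_setU1 => /andP[-> /orP[/eqP|]]; first by right.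
    by left.
  exfalso; apply: (negP (_ : ~~ (#|S'| <= #|S|))).
    by rewrite -ltnNge /S' cardsU1 uvS add1n.
  apply: Smax.
  move: uL vL; rewrite !inE => /andP[uW ud] /andP[vW vd].
  apply/boolp.asboolP; split.
      - move=> p; rewrite in_setU1 => /predU1P[->|/SW //].
        by apply/subsetP => x; rewrite !inE => /orP[]/eqP->.
      - move=> c /andP[c2 ck] cyc; case/negP: vb.
        apply: (subsetP (ball_mono e u (leqW ck))).
        by apply: (new_cycle_path esym e'e c2 cyc); apply: Scyc; rewrite c2.
      - have one x y : deg e [set: T] x < d ->
            (forall z, e' x z -> e x z \/ z = y) -> deg e' [set: T] x <= d.
          move=> xd H; apply: leq_trans xd; apply: (@leq_trans #|y |: [set z in [set: T] | e x z]|).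
            apply: subset_leq_card; apply/subsetP => z; rewrite !inE => /H[->|->].
              by rewrite orbT.
            by rewrite eqxx.
          by rewrite cardsU1 -[in X in _ <= X]add1n leq_add2r leq_b1.
        have new x z : e' x z -> e x z \/ (x == u) && (z == v) || (x == v) && (z == u).
          move=> xz; case: (e'e _ _ xz) => [|E]; [by left|right].
          have xnz : x != z by case/andP: xz.
          have : x \in [set u; v] by rewrite -E !inE eqxx.
          have : z \in [set u; v] by rewrite -E !inE eqxx orbT.
          by rewrite !inE => /orP[]/eqP zE /orP[]/eqP xE; subst x z; rewrite ?eqxx ?orbT // in xnz *.
        move=> x; rewrite -/e'; case: (eqVneq x u) => [->|xu].
          apply: (one u v) => // z /new[|/orP[]/andP[/eqP E /eqP zE]]; [by left|by right|].
          by rewrite E eqxx in uv.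
        case: (eqVneq x v) => [->|xv].
          apply: (one v u) => // z /new[|/orP[]/andP[/eqP E /eqP zE]]; [by left| |by right].
          by rewrite E eqxx in uv.
        apply: leq_trans (Sdeg x); apply: subset_leq_card; apply/subsetP => z.
        by rewrite !inE => /new[//|]; rewrite (negbTE xu) (negbTE xv).
apply: (@leq_trans (\sum_(v in W :\: L) d)).
  rewrite sum_nat_const mulnC leq_mul2r; apply/orP; right.
  have := cardsID L W; have := subset_leq_card (subsetIr W L); move: cL; clear; lia.
apply: (@leq_trans (\sum_(v in W :\: L) deg e [set: T] v)).
  by apply: leq_sum => v; rewrite !inE => /andP[+ vW]; rewrite vW /= -leqNgt.
rewrite [leqRHS](big_setID (W :\: L)) /= setTI leq_addr //.
Qed.

(** * Densities *)

Section Densities.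
Variable R : realType.

Lemma density_le1 (G : sgraph) : (density R G <= 1)%R.
Proof.
rewrite /density; have := card_edges_le G; case: (posnP 'C(#|G|, 2)) => [->|b0 eb].
  by rewrite invr0 mulr0 ler01.
by rewrite ler_pdivrMr ?ltr0n // mul1r ler_nat.
Qed.

Lemma density_le_max (F : graph_family) (G : sgraph) :
  F G -> (density R G <= max_density R F #|G|)%R.
Proof.
move=> FG; apply: sup_ubound; last by exists G.
by exists 1%R => _ [H [_ _ ->]]; exact: density_le1.
Qed.

Lemma extremal_graph (F : graph_family) (G0 : sgraph) : F G0 ->
  exists G, [/\ F G, #|G| = #|G0|, max_density R F #|G0| = density R G &
    #|edges G0| <= #|edges G|].
Proof.
move=> FG0.
pose P k := boolp.asbool (exists G, [/\ F G, #|G| = #|G0| & #|edges G| = k]).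
have exP : exists k, P k by exists #|edges G0|; apply/boolp.asboolP; exists G0.
have leP k : P k -> k <= 'C(#|G0|, 2).
  by move/boolp.asboolP => [G [_ <- <-]]; exact: card_edges_le.
case: (ex_maxnP exP leP) => k /boolp.asboolP[G [FG cG eG]] kmax.
have max H : F H -> #|H| = #|G0| -> #|edges H| <= #|edges G|.
  by move=> FH cH; rewrite eG; apply: kmax; apply/boolp.asboolP; exists H.
exists G; split=> //; last exact: max.
apply/le_anti/andP; split; last by rewrite -cG; exact: density_le_max.
apply: ge_sup; first by exists (density R G0); exists G0.
move=> _ [H [FH cH ->]]; rewrite /density cH cG ler_wpM2r ?invr_ge0 //.
by rewrite ler_nat max.
Qed.

Lemma bigminn_le (I : eqType) (r : seq I) x (E : I -> nat) i :
  i \in r -> \big[minn/x]_(j <- r) E j <= E i.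
Proof.
elim: r => // j r IH; rewrite inE big_cons geq_min => /predU1P[->|/IH ->].
  by rewrite leqnn.
by rewrite orbT.
Qed.

Lemma bigminn_le_idx (I : eqType) (r : seq I) x (E : I -> nat) :
  \big[minn/x]_(j <- r) E j <= x.
Proof. by elim: r => [|j r IH]; rewrite ?big_nil // big_cons geq_min IH orbT. Qed.

Lemma edit_density_le1 (G B : sgraph) : (edit_density R G B <= 1)%R.
Proof.
rewrite /edit_density; set E := \big[minn/_]_(f <- _) _.
have : E <= 'C(#|G|, 2) by exact: bigminn_le_idx.
case: (posnP 'C(#|G|, 2)) => [->|b0 eb]; first by rewrite invr0 mulr0 ler01.
by rewrite ler_pdivrMr ?ltr0n // mul1r ler_nat.
Qed.

Lemma edit_density_le (G : sgraph) m (f : G -> 'I_m) :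
  (edit_density R G (complete_graph m) <=
   (edit_dist (@adj G) (@adj (blowup (f : G -> complete_graph m))))%:R
     / 'C(#|G|, 2)%:R)%R.
Proof.
rewrite /edit_density ler_wpM2r ?invr_ge0 // ler_nat.
have <- : (fun v => [ffun v => f v : complete_graph m] v) = f.
  by apply: boolp.funext => v; rewrite ffunE.
by apply: (bigminn_le _ (fun g : {ffun G -> complete_graph m} =>
  edit_dist (@adj G) (@adj (blowup g)))); exact: mem_index_enum.
Qed.

(** One edit changes the number of edges by one, and no complete m-partite graph on mq vertices has
    more edges than K_m^q. *)
Lemma edit_density_ge (G : sgraph) m q k : #|G| = m * q ->
  #|edges (complete_blowup m q)| + k <= #|edges G| ->
  (k%:R / 'C(#|G|, 2)%:R <= edit_density R G (complete_graph m))%R.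
Proof.
move=> cG ek; rewrite /edit_density ler_wpM2r ?invr_ge0 // ler_nat.
(* The first case is the default value of the minimum, the number of all pairs; it is at least k
   because G already has k edges. *)
apply: (big_ind (fun v => k <= v)) => [|x y kx ky|f _].
- by apply: leq_trans (card_edges_le G); apply: leq_trans ek; exact: leq_addl.
- by rewrite leq_min kx ky.
- have := double_edit_dist (f : G -> 'I_m) (@adj_sym G) (@adj_irr G).
  have := vol_blowup_balance (f : G -> 'I_m) (@adj G).
  have := vol_blowup_le (f : G -> 'I_m) cG.
  rewrite -double_card_edges.
  have := double_card_edges G; have := double_card_edges (complete_blowup m q).
  move: (vol _ _) (vol _ _) (vol _ _) (internal _ _ _) (\sum_v _) (edit_dist _ _).
  by move: ek; clear; lia.
Qed.

End Densities.

(** * Stability from the counting bounds, and graphs that violate it *)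

Lemma card_blowup_part m q (i : 'I_m) : #|blowup_part q i| = q.
Proof.
rewrite (@eq_card _ _ [set (i, a) | a : 'I_q]).
  by rewrite card_imset ?card_ord // => a b [].
move=> [k a]; rewrite !inE /=; apply/eqP/imsetP => [->|[b _ [-> _]] //].
by exists a.
Qed.

Lemma card_edges_add m q (i : 'I_m) (S : {set {set complete_blowup m q}}) :
  (forall e, e \in S -> e \subset blowup_part q i) ->
  #|edges (complete_blowup m q)| + #|edges (graph_of S)| <= #|edges (add_edges S)|.
Proof.
move=> Si.
have same (u v : complete_blowup m q) : [set u; v] \in S -> u.1 = v.1.
  move/Si/subsetP => H; have := H u; have := H v; rewrite !inE !eqxx orbT.
  by move=> /(_ isT)/eqP-> /(_ isT)/eqP->.
rewrite -(@cardsUI _ (edges (complete_blowup m q)) (edges (graph_of S))) addnC.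
rewrite [X in X + _](_ : _ = 0) ?add0n.
  apply: subset_leq_card; apply/subsetP => e; rewrite inE.
  case/orP => /imsetP[[u v]]; rewrite inE /= => uv ->.
    have uvA : adj (u : add_edges S) v.
      rewrite adj_add_edges (uv : adj (u : complete_blowup m q) v) andbT.
      by apply: contraNneq uv => ->.
    by apply/imsetP; exists (u, v).
  have uvA : adj (u : add_edges S) v.
    by rewrite adj_add_edges; case/andP: uv => -> ->; rewrite orbT.
  by apply/imsetP; exists (u, v).
apply/eqP; rewrite cards_eq0 -subset0; apply/subsetP => e; rewrite inE => /andP[H1].
case/imsetP: H1 => [[u v]]; rewrite inE /= => uv ->.
rewrite (edgesP (u : graph_of S) v) => /andP[_ /same uv'].
by rewrite uv' eqxx in uv.
Qed.

Lemma forest_acyclic m q (i : 'I_m) (S : {set {set complete_blowup m q}}) :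
  is_forest (graph_of S) ->
  acyclic (fun a b : 'I_q => (a != b) && ([set (i, a); (i, b)] \in S)).
Proof.
move=> Sf c c2 /andP[cyc uc]; pose h (a : 'I_q) : complete_blowup m q := (i, a).
have hI : injective h by move=> a b [].
apply: (Sf (map h c)); first by rewrite size_map.
apply/andP; split; last by rewrite map_inj_uniq.
case: c c2 cyc uc => // a c _ cyc _.
rewrite /cycle /= -map_rcons path_map; move: cyc; rewrite /cycle.
by apply: sub_path => x y /= /andP[xy xyS]; rewrite xyS andbT (inj_eq hI).
Qed.

Lemma single_edge_forest (G : sgraph) (x y : G) : is_forest (graph_of [set [set x; y]]).
Proof.
move=> c c2 /andP[cyc uc].
have cxy : {subset c <= [:: x; y]}.
  move=> u uc'; have /andP[_] := next_cycle cyc uc'.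
  rewrite inE => /eqP E; have : u \in [set x; y] by rewrite -E !inE eqxx.
  by rewrite !inE.
by have := uniq_leq_size uc cxy; rewrite leqNgt c2.
Qed.

(** A gap of at least eps/2 is trivial, since edit density is at most 1. Below that, a balanced
    blow-up shows that G is dense enough for [linear_stability], and the blow-up on the resulting
    cut bounds M - B by the gap. *)
Lemma stability_rate (R : realType) (F : graph_family) m q (i : 'I_m)
    (S : {set {set complete_blowup m q}}) :
  min_chi F m.+1 -> 1 < m ->
  (forall e, e \in S -> e \subset blowup_part q i) -> is_forest (graph_of S) ->
  ~ Forb (up F) (add_edges S) ->
  exists2 C : R, (0 < C)%R & forall G, Forb (up F) G -> (C <= #|G|%:R)%R ->
    let gap := (max_density R (Forb (up F)) #|G| - density R G)%R in
    (edit_density R G (complete_graph m) <= C * Num.max (#|G|%:R^-1) gap)%R /\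
    ((exists x y, S = [set [set x; y]]) ->
      edit_density R G (complete_graph m) <= C * gap)%R.
Proof.
move=> hmin m1 Si Sf /not_ForbP[H FH HS].
have m0 : 0 < m by apply: ltnW.
pose J (a b : 'I_q) := (a != b) && ([set (i, a); (i, b)] \in S).
have nopat G : Forb (up F) G -> ~ has_pattern (@adj G) m J.
  move=> /Forb_upP FG /(pattern_embeds Si) SG.
  exact: FG FH (embeds_trans HS SG).
(* For q = 0 the pattern is empty and occurs in every graph, so no graph is admissible. *)
case: (posnP q) => [q00|q0].
  exists 1%R => // G /nopat[]; exists 0, (fun=> set0).
  have no (a : 'I_q) : False by move: (ltn_ord a); rewrite {2}q00.
  exists (fun a => False_rect _ (no a)); split=> //; try by move=> a; case: (no a).
  split=> [k _ _|a|k l _ _ _ _ _ u v]; last by rewrite inE.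
    by rewrite [X in X <= _]q00.
  by case: (no a).
have Jsym : symmetric J by move=> a b; rewrite /J eq_sym setUC.
have Jirr : irreflexive J by move=> a; rewrite /J eqxx.
have [eps eps0 [C0 [n0 lin]]] :=
  linear_stability R m1 q0 Jsym Jirr (forest_acyclic (i := i) Sf).
(* 2/eps covers large gaps and makes the linear error of the balanced cut at most (eps/2) n^2. The 3
   is the ratio of B + M to M - B when 2 B <= M, and 4 C0 turns the error C0 n into a multiple of
   1/n in density. *)
pose C : R := (n0%:R + 2%:R + 2%:R / eps + 3%:R + 4%:R * C0%:R)%R.
have e20 : (0 < 2%:R / eps)%R by rewrite divr_gt0.
have n00 : (0 <= n0%:R :> R)%R by [].
have C00 : (0 <= C0%:R :> R)%R by [].
have C1 : (2%:R / eps <= C)%R by rewrite /C; lra.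
have C2 : (n0%:R <= C)%R by rewrite /C; lra.
have C3 : (3%:R + 4%:R * C0%:R <= C)%R by rewrite /C; lra.
have C4 : (2%:R <= C)%R by rewrite /C; lra.
have Cp : (0 < C)%R by lra.
exists C => // G FG CG gap.
have [N HN] : exists N : R, N = (#|G|%:R)%R by eexists.
rewrite -HN in CG *.
have gap0 : (0 <= gap)%R by rewrite subr_ge0 density_le_max.
have gapmax : (gap <= Num.max N^-1 gap)%R by rewrite le_max lexx orbT.
case: (lerP (eps / 2%:R) gap) => [big|small].
  suff H1 : (edit_density R G (complete_graph m) <= C * gap)%R.
    by split=> // ; apply: le_trans H1 _; rewrite ler_pM2l.
  apply: le_trans (edit_density_le1 _ _ _) _.
  apply: (@le_trans _ _ (2%:R / eps * (eps / 2%:R))%R).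
    by rewrite (_ : _ * _ = 1)%R //; field; rewrite gt_eqF.
  apply: (@le_trans _ _ (2%:R / eps * gap)%R); first by rewrite ler_pM2l.
  by rewrite ler_wpM2r.
have n2 : 2 <= #|G| by rewrite -(ler_nat R) -HN; lra.
have N2 : (2%:R <= N)%R by rewrite HN ler_nat.
have n0G : n0 <= #|G| by rewrite -(ler_nat R) -HN; lra.
have [D HD] : exists D : R, D = ('C(#|G|, 2)%:R)%R by eexists.
have D2 : (2%:R * D = N * (N - 1))%R.
  have : 'C(#|G|, 2).*2 = #|G| * #|G|.-1.
    by rewrite bin2 -[RHS]odd_double_half oddM; case: #|G| n2 => // n _ /=; case: (odd n).
  move/(congr1 (fun n => n%:R : R)%R); rewrite -muln2 !natrM -HD -HN -subn1 natrB ?(ltnW n2) //.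
  by rewrite -HN mulrC.
have D0 : (0 < D)%R.
  have : (0 < N * (N - 1))%R by rewrite mulr_gt0; lra.
  lra.
have volR (K : sgraph) : ((vol (@adj K) [set: K])%:R = 2%:R * #|edges K|%:R :> R)%R.
  by rewrite -double_card_edges -muln2 natrM mulrC.
have blow (f : G -> 'I_m) :
    ((vol (@adj (blowup (f : G -> complete_graph m))) [set: G])%:R <=
     (vol (@adj G) [set: G])%:R + 2%:R * (gap * D))%R.
  have := density_le_max R (colorable_Forb hmin (blowup_colorable (f : G -> complete_graph m))).
  have -> : max_density R (Forb (up F)) #|blowup (f : G -> complete_graph m)| =
      (density R G + gap)%R by rewrite /gap addrCA subrr addr0.
  have cb : #|blowup (f : G -> complete_graph m)| = #|G| by [].
  rewrite /density cb -HD ler_pdivrMr // mulrDl divfK ?gt_eqF //.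
  rewrite (volR (blowup (f : G -> complete_graph m))) volR; lra.
have [fb Hfb] := balanced_cut G m0.
have volG : ((1 - m%:R^-1 - eps) * N ^+ 2 <= (vol (@adj G) [set: G])%:R)%R.
  move: Hfb; rewrite -(ler_nat R) !natrM natrD -HN -subn1 natrB // => Hfb.
  have mp : (0 < m%:R :> R)%R by rewrite ltr0n.
  have Vb := blow fb.
  have Hfb' : (N ^+ 2 * (1 - m%:R^-1) <=
      (vol (@adj (blowup (fb : G -> complete_graph m))) [set: G])%:R + N)%R.
    rewrite -(ler_pM2l mp); apply: le_trans Hfb.
    by rewrite le_eqVlt; apply/orP; left; apply/eqP; field; rewrite gt_eqF.
  have gD : (2%:R * (gap * D) <= eps / 2%:R * N ^+ 2)%R.
    rewrite mulrCA D2; apply: (@le_trans _ _ (gap * N ^+ 2)%R).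
      rewrite ler_wpM2l // expr2 ler_wpM2l //; lra.
    by rewrite ler_wpM2r ?sqr_ge0 // ltW.
  have epsN : (N <= eps / 2%:R * N ^+ 2)%R.
    have : (2%:R <= eps * N)%R.
      have : (2%:R / eps <= N)%R by lra.
      by rewrite ler_pdivrMr // mulrC.
    rewrite expr2 mulrA => H1; rewrite -{1}[N]mul1r ler_wpM2r //; lra.
  move: Hfb'; lra.
have [|f [fC fsingle]] := lin G (@adj G) (@adj_sym G) (@adj_irr G) n0G _ (nopat G FG).
  by rewrite -HN.
have ED := double_edit_dist f (@adj_sym G) (@adj_irr G).
have BL := vol_blowup_balance f (@adj G).
have Vf := blow f.
move/(congr1 (fun n => n%:R : R)%R): ED; rewrite -muln2 natrM natrD => ED.
move/(congr1 (fun n => n%:R : R)%R): BL; rewrite !natrD => BL.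
have edit := edit_density_le R f; rewrite -HD in edit.
have H1 : (internal (@adj G) [set: G] f).*2 <= \sum_v missing (@adj G) f v ->
    (edit_density R G (complete_graph m) <= C * gap)%R.
  move=> half; apply: le_trans edit _; rewrite ler_pdivrMr //.
  apply: (@le_trans _ _ (3%:R * gap * D)%R); last first.
    by rewrite ler_wpM2r ?(ltW D0) // ler_wpM2r //; lra.
  move: half; rewrite -(ler_nat R) -muln2 natrM => half; lra.
split.
  apply: le_trans edit _; rewrite ler_pdivrMr //.
  apply: (@le_trans _ _ ((3%:R * gap + 4%:R * C0%:R * N^-1) * D)%R); last first.
    rewrite ler_wpM2r ?(ltW D0) //; apply: (@le_trans _ _ ((3%:R + 4%:R * C0%:R) * Num.max N^-1 gap)%R).
      have : (C0%:R * N^-1 <= C0%:R * Num.max N^-1 gap)%R by rewrite ler_wpM2l // le_max lexx.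
      move: gapmax; move: (Num.max _ _) => mx; lra.
    by rewrite ler_wpM2r // (le_trans gap0).
  have C0N : (C0%:R * N <= 4%:R * C0%:R * N^-1 * D)%R.
    have -> : (4%:R * C0%:R * N^-1 * D = 2%:R * C0%:R * N^-1 * (2%:R * D))%R by ring.
    rewrite D2 (_ : _ * (N * (N - 1)) = C0%:R * (2%:R * (N - 1)))%R.
      by rewrite ler_wpM2l //; lra.
    by field; rewrite gt_eqF //; lra.
  move: fC; rewrite -(ler_nat R) -muln2 natrM natrD natrM -HN => fC; lra.
case=> x [y SE]; apply: H1; apply: fsingle.
have xy1 u : u \in [set x; y] -> u.1 = i.
  move=> uxy; have := Si [set x; y]; rewrite SE inE eqxx => /(_ isT)/subsetP/(_ u uxy).
  by rewrite inE => /eqP.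
exists x.2, y.2 => a b /andP[ab]; rewrite SE inE => /eqP E.
have : (i, a) \in [set x; y] by rewrite -E !inE eqxx.
have : (i, b) \in [set x; y] by rewrite -E !inE eqxx orbT.
rewrite !inE => /orP[]/eqP bE /orP[]/eqP aE.
- by move: ab; rewrite -[a]/((i, a).2) -[b]/((i, b).2) aE bE eqxx.
- by rewrite -aE -bE /= !eqxx orbT.
- by rewrite -aE -bE /= !eqxx.
- by move: ab; rewrite -[a]/((i, a).2) -[b]/((i, b).2) aE bE eqxx.
Qed.

(** Passing to an extremal graph makes the gap zero, so a stability bound is left with its error
    term alone: 0 in the perfect case, C/n in the robust one. *)
Lemma unstable_witness (R : realType) (F : graph_family) m q (i : 'I_m)
    (S : {set {set complete_blowup m q}}) :
  (forall e, e \in S -> e \subset blowup_part q i) -> Forb (up F) (add_edges S) ->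
  exists G, [/\ Forb (up F) G, #|G| = m * q,
    max_density R (Forb (up F)) #|G| = density R G &
    (#|edges (graph_of S)|%:R / 'C(m * q, 2)%:R <=
      edit_density R G (complete_graph m))%R].
Proof.
move=> Si FS; have [G [FG cG dG eG]] := extremal_graph R FS.
have cS : #|add_edges S| = m * q by rewrite /= card_prod !card_ord.
rewrite cS in cG; exists G; split=> //; first by rewrite cG -cS.
rewrite -cG; apply: edit_density_ge cG _.
exact: leq_trans (card_edges_add Si) eG.
Qed.

Lemma sub_graph_of_embeds (G H : sgraph) (S : {set {set G}}) (f : H -> add_edges S) :
  injective f -> (forall u v, adj u v -> adj (f u) (f v)) ->
  embeds H (add_edges [set p in S | p \subset [set f u | u : H]]).
Proof.
move=> fI fe; exists f => // u v /fe.
rewrite !adj_add_edges => /andP[-> /orP[->//|uvS]]; rewrite inE uvS.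
apply/orP; right; apply/subsetP => x.
by rewrite !inE => /orP[]/eqP->; apply: imset_f.
Qed.

(** A cycle formed by pairs inside [W] has at most [#|W|] vertices, hence would be one of the
    excluded short cycles. *)
Lemma short_cycles_forest (T : finType) (S : {set {set T}}) (W : {set T}) k :
  #|W| <= k -> (forall c : seq T, 2 < size c <= k -> ~ ucycle (@adj (graph_of S)) c) ->
  is_forest (graph_of [set p in S | p \subset W]).
Proof.
move=> Wk Sk c c2 /andP[cyc uc].
have sub u v : adj (u : graph_of [set p in S | p \subset W]) v ->
    adj (u : graph_of S) v /\ u \in W.
  rewrite /= inE => /and3P[-> -> /subsetP uvW]; split=> //.
  by apply: uvW; rewrite !inE eqxx.
apply: (Sk c).
  rewrite c2 /=; apply: leq_trans Wk; rewrite -(card_uniqP uc).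
  apply: subset_leq_card; apply/subsetP => u uc'.
  by case: (sub _ _ (next_cycle cyc uc')).
rewrite /ucycle uc andbT; apply: cycle_from_next => // u uc'.
by case: (sub _ _ (next_cycle cyc uc')).
Qed.

Theorem theorem1p11 (R : realType) (F : graph_family) (m : nat)
    (hmin : min_chi F m.+1) (hm : 2 <= m) :
  (perfectly_stable R (Forb (up F)) (complete_graph m) <->
     exists (q : nat) (x y : complete_blowup m q),
       [/\ x != y, ~~ adj x y &
           ~ Forb (up F) (add_edges [set [set x; y]])])
  /\
  (finite_family F ->
     (robustly_stable R (Forb (up F)) (complete_graph m) <->
        exists (q : nat) (i : 'I_m) (S : {set {set complete_blowup m q}}),
          [/\ forall e, e \in S -> e \subset blowup_part q i,
              is_forest (graph_of S) &
              ~ Forb (up F) (add_edges S)])).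
Proof.
have m0 : 0 < m by apply: ltnW.
split; last move=> [nF [s Fs]]; split.
- case=> C C0 stab; apply: boolp.contrapT => none.
  (* At least 2, so that [ord0] and [ord_max] are different vertices of the part. *)
  have [q0 Hq0] := exists_nat_ge C; pose q := q0.+2.
  pose x : complete_blowup m q := (Ordinal m0, ord0).
  pose y : complete_blowup m q := (Ordinal m0, ord_max).
  have xy : x != y by rewrite xpair_eqE eqxx.
  have Si e : e \in [set [set x; y]] -> e \subset blowup_part q (Ordinal m0).
    by rewrite inE => /eqP->; apply/subsetP => u; rewrite !inE => /orP[]/eqP->.
  have FS : Forb (up F) (add_edges [set [set x; y]]).
    by apply: boolp.contrapT => nFS; apply: none; exists q, x, y; split=> //; rewrite /= eqxx.
  have [G [FG cG dG eG]] := unstable_witness R Si FS.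
  have CG : (C <= #|G|%:R)%R.
    apply: le_trans Hq0 _; rewrite cG ler_nat /q; have := m0; clear; nia.
  have := stab G FG CG; rewrite dG subrr mulr0 leNgt => /negP; apply.
  apply: lt_le_trans eG; apply: divr_gt0; rewrite ltr0n.
    by apply/card_gt0P; exists [set x; y]; rewrite (edgesP (x : graph_of _)); apply/andP; split=> //; rewrite inE.
  rewrite bin_gt0 /q; have := hm; clear; nia.
- case=> q [x [y [xy nxy nF]]].
  have xy1 : x.1 = y.1 by apply/eqP; rewrite -[_ == _]negbK.
  have Si e : e \in [set [set x; y]] -> e \subset blowup_part q x.1.
    by rewrite inE => /eqP->; apply/subsetP => u; rewrite !inE => /orP[]/eqP->; rewrite ?xy1.
  have [C C0 stab] := stability_rate R hmin hm Si (@single_edge_forest _ x y) nF.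
  exists C => // G FG CG; have [_] := stab G FG CG; apply.
  by exists x, y.
- case=> C C0 stab; apply: boolp.contrapT => none.
  pose k := \max_(i < nF) #|s i|.
  have Hk H : F H -> #|H| <= k.
    case/Fs => i [f fbij _]; rewrite (bij_eq_card fbij); exact: leq_bigmax.
  (* Robust stability would allow at most C(mq - 1)/2 added edges, whereas [erdos_sachs] provides
     dq/4, which is more once d >= 2Cm. *)
  have [d Hd] := exists_nat_ge (2%:R * C * m%:R)%R.
  have [n0 Hn0] := exists_nat_ge C.
  (* At most c vertices of the part have degree below d; q > 2c leaves more than half of the part
     with full degree, and q > n0 makes the order exceed C. *)
  pose c := d.+1 ^ k.+1; pose q := (2 * c + n0).+1; pose i := Ordinal m0.
  have [S [Si Scyc Svol]] := erdos_sachs (blowup_part q i) d k.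
  have FS : Forb (up F) (add_edges S).
    apply/Forb_upP => H FH [f fI fe].
    pose S' := [set p in S | p \subset [set f u | u : H]].
    apply: none; exists q, i, S'; split.
    - by move=> e; rewrite inE => /andP[/Si].
    - apply: (short_cycles_forest _ Scyc).
      by apply: leq_trans (Hk H FH); exact: leq_imset_card.
    - by apply/not_ForbP; exists H => //; exact: sub_graph_of_embeds.
  have [G [FG cG dG eG]] := unstable_witness R Si FS.
  have n2 : 2 <= m * q by rewrite /q; have := hm; clear; nia.
  have CG : (C <= #|G|%:R)%R.
    apply: le_trans Hn0 _; rewrite cG ler_nat /q; have := m0; clear; nia.
  have := le_trans eG (stab G FG CG); rewrite dG subrr cG.
  have nR0 : (0 < (m * q)%:R :> R)%R by rewrite ltr0n ltnW.
  have -> : Num.max (m * q)%:R^-1%R 0%R = ((m * q)%:R^-1 :> R)%R.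
    by apply/max_idPl; rewrite invr_ge0 ltW.
  have bE : 'C(m * q, 2).*2 = (m * q) * (m * q).-1.
    by rewrite bin2 -[RHS]odd_double_half oddM; case: (m * q) n2 => // n _ /=; case: (odd n).
  have b0 : (0 < 'C(m * q, 2)%:R :> R)%R by rewrite ltr0n bin_gt0.
  move/(congr1 (fun n => n%:R : R)%R): bE.
  rewrite -muln2 natrM (natrM _ (m * q)) -subn1 natrB ?(ltnW n2) // => bE.
  rewrite card_blowup_part -double_card_edges in Svol.
  have Sq : d * q <= 4 * #|edges (graph_of S)|.
    have dq : d * q <= 2 * (d * (q - c)) by rewrite /q; clear; nia.
    apply: leq_trans dq _; rewrite -/c in Svol; move: Svol; rewrite -muln2; clear; lia.
  move: Sq; rewrite -(ler_nat R) natrM (natrM _ 4) => Sq.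
  rewrite ler_pdivrMr // => eS.
  have {}eS : (#|edges (graph_of S)|%:R * 2%:R <= C * ((m * q)%:R - 1))%R.
    have CE : (C * (m * q)%:R^-1 * 'C(m * q, 2)%:R * 2%:R = C * ((m * q)%:R - 1))%R.
      by rewrite -mulrA bE mulrA divfK // gt_eqF.
    by rewrite -CE ler_pM2r.
  have dq : (2%:R * C * m%:R * q%:R <= d%:R * q%:R)%R by rewrite ler_wpM2r.
  have mq : ((m * q)%:R = m%:R * q%:R :> R)%R by rewrite natrM.
  rewrite mq in eS; lra.
- case=> q [i [S [Si Sf nFS]]].
  have [C C0 stab] := stability_rate R hmin hm Si Sf nFS.
  by exists C => // G FG CG; have [] := stab G FG CG.
Qed.
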